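(* Let $\omega\in\Omega$ and let $\tau^{(0)}(x)$, $\tau^{(1)}(x)$ be nonzero meromorphic functions on $H_{\omega}$ and $H_{\omega+\delta}$, respectively, such that $$\frac{\tau^{(0)}(x\pm b_1\delta)}{\tau^{(0)}(x\pm b_2\delta)}=\frac{[(b_0\pm b_1|x)]}{[(b_0\pm b_2|x)]}\quad(x\in H_{\omega})$$ for any $C_3$-frame $\{\pm b_0,\pm b_1,\pm b_2\}$ of type $\mathrm{II}_1$ with $(\phi|b_0)=1$, $(\phi|b_1)=(\phi|b_2)=0$, and $$[(b_1\pm b_2|x)]\tau^{(0)}(x-b_0\delta)\tau^{(1)}(x+b_0\delta)+[(b_2\pm b_0|x)]\tau^{(0)}(x-b_1\delta)\tau^{(1)}(x+b_1\delta)+[(b_0\pm b_1|x)]\tau^{(0)}(x-b_2\delta)\tau^{(1)}(x+b_2\delta)=0\quad(x\in H_{\omega+\delta/2})$$ for any $C_3$-frame $\{\pm b_0,\pm b_1,\pm b_2\}$ with $(\phi|b_0)=(\phi|b_1)=(\phi|b_2)=\frac12$. Let $\tau(x)$ be the unique hypergeometric $\tau$-function on $D_\omega=\bigsqcup_{n\in\mathbb{Z}}H_{\omega+n\delta}$ whose components of index $0$ and $1$ are $\tau^{(0)}$ and $\tau^{(1)}$, and let $\tau^{(n)}=\tau|_{H_{\omega+n\delta}}$. Let $\{\pm a_0,\pm a_1,\pm a_2\}$ be a $C_3$-frame of type $\mathrm{II}_1$ with $(\phi|a_0)=1$, $(\phi|a_1)=(\phi|a_2)=0$, and suppose that $\tau^{(1)}(x)$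 is expressed in the form $\tau^{(1)}(x)=g^{(1)}(x)\psi(x)$ on $H_{\omega+\delta}$ with a nonzero meromorphic function $g^{(1)}(x)$ such that $$\frac{g^{(1)}(x\pm a_1\delta)}{g^{(1)}(x\pm a_2\delta)}=\frac{[(a_0\pm a_1|x)]}{[(a_0\pm a_2|x)]}\qquad(x\in H_{\omega+\delta}).$$ Then the components of $\tau(x)$ are expressed in terms of $2$-directional Casorati determinants: $$\tau^{(n)}(x)=g^{(n)}(x)K^{(n)}(x),\qquad K^{(n)}(x)=\det\big(\psi^{(n)}_{ij}(x)\big)_{i,j=1}^{n}\qquad(x\in H_{\omega+n\delta})$$ for $n=0,1,2,\ldots$, where $$\psi^{(n)}_{ij}(x)=\psi\big(x-(n-1)a_0\delta+(n+1-i-j)a_1\delta+(j-i)a_2\delta\big)\qquad(i,j=1,\ldots,n),$$ and the gauge factors $g^{(n)}(x)$ on $H_{\omega+n\delta}$ are determined inductively from $g^{(0)}(x)=\tau^{(0)}(x)$ and $g^{(1)}(x)$ by $$\frac{g^{(n-1)}(x-a_0\delta)\,g^{(n+1)}(x+a_0\delta)}{g^{(n)}(x\pm a_1\delta)}=\frac{[(a_0\pm a_2|x)]}{[(a_1\pm a_2|x)]}\qquad(x\in H_{\omega+n\delta},\ n=1,2,\ldots).$$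
   Context: Let $V=\mathbb{C}^8$ with canonical basis $v_0,\ldots,v_7$ and the symmetric $\mathbb{C}$-bilinear form $(\cdot|\cdot)$ with $(v_i|v_j)=\delta_{ij}$. Put $\phi=\frac12(v_0+\cdots+v_7)$ and $P=\{a\in\mathbb{Z}^8\cup(\phi+\mathbb{Z}^8): (\phi|a)\in\mathbb{Z}\}$ (the $E_8$ root lattice). For $\kappa\in\mathbb{C}$ put $H_\kappa=\{x\in V:(\phi|x)=\kappa\}$. A $C_3$-frame is a set $\{\pm a_0,\pm a_1,\pm a_2\}\subset V$ of six vectors such that $(a_i|a_j)=\delta_{ij}$, $a_i\pm a_j\in P$ for $i<j$ and $2a_i\in P$. It is of type $\mathrm{II}_1$ if the multiset of the values $(\phi|a)$, $a$ in the frame, is $\{1,-1,0,0,0,0\}$. Fix a nonzero entire function $[z]$ satisfying $[\beta\pm\gamma][z\pm\alpha]+[\gamma\pm\alpha][z\pm\beta]+[\alpha\pm\beta][z\pm\gamma]=0$ for all $z,\alpha,\beta,\gamma\in\mathbb{C}$, where $[\alpha\pm\beta]=[\alpha+\beta][\alpha-\beta]$. Let $\Omega=\{\omega\in\mathbb{C}:[\omega]=0\}$ and fix $\delta\neq0$ in $\mathbb{C}$ with $\mathbb{Z}\delta\cap\Omega=\{0\}$. Double signs denote products: $f(x\pm a\delta)=f(x+a\delta)f(x-a\delta)$, $[(a\pm b|x)]=[(a+b|x)][(a-b|x)]$. For $D\subseteq V$ with $D+P\delta=D$, a function $\tau$ on $D$ is an ORG $\tau$-function if for all $C_3$-frames $\{\pm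 a,\pm b,\pm c\}$ $$[(b\pm c|x)]\tau(x\pm a\delta)+[(c\pm a|x)]\tau(x\pm b\delta)+[(a\pm b|x)]\tau(x\pm c\delta)=0$$ for all $x$ such that $x\pm a\delta,x\pm b\delta,x\pm c\delta\in D$. A meromorphic ORG $\tau$-function $\tau$ on $D_\omega$ is a hypergeometric $\tau$-function if $\tau|_{H_{\omega+n\delta}}=0$ for $n<0$ and $\tau|_{H_\omega}\not\equiv0$. Under the stated hypotheses on $\tau^{(0)},\tau^{(1)}$ a hypergeometric $\tau$-function with these two components exists and is unique. The $0\times0$ determinant is $1$. *)

(* Defs.v *)
From HB Require Import structures.
From mathcomp Require Import all_boot all_order all_algebra.
From mathcomp Require Import complex.
From mathcomp Require Import all_classical all_reals all_analysis.

Set Implicit Arguments.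
Unset Strict Implicit.
Unset Printing Implicit Defensive.

Import Order.TTheory GRing.Theory Num.Theory.
Import numFieldNormedType.Exports.

Local Open Scope classical_set_scope.
Local Open Scope complex_scope.
Local Open Scope ring_scope.

(* The library puts no topology on R[i]; give it the one of its norm. *)
HB.instance Definition _ (R : rcfType) := NormedModule.copy R[i] R[i]^o.

Notation C8 R := 'rV[R[i]]_8.

Definition dot (R : realType) (u v : C8 R) : R[i] := \sum_i u 0 i * v 0 i.

Definition phi (R : realType) : C8 R := \row_(j < 8) 2^-1.

Definition is_int (R : realType) (z : R[i]) : Prop := exists k : int, z = k%:~R.

Definition Z8 (R : realType) : set (C8 R) := [set a | forall i, is_int (a 0 i)].

Definition E8_lattice (R : realType) : set (C8 R) :=
  [set a | (Z8 a \/ Z8 (a - phi R)) /\ is_int (dot (phi R) a)].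

Definition hyperplane (R : realType) (kappa : R[i]) : set (C8 R) :=
  [set x | dot (phi R) x = kappa].

Definition frame_vectors (R : realType) (a0 a1 a2 : C8 R) : seq (C8 R) :=
  [:: a0; - a0; a1; - a1; a2; - a2].

Definition C3_frame (R : realType) (a0 a1 a2 : C8 R) : Prop :=
  let a := tnth [tuple a0; a1; a2] in
  [/\ forall i j : 'I_3, dot (a i) (a j) = (i == j)%:R,
      forall i j : 'I_3, (i < j)%N ->
        E8_lattice (a i + a j) /\ E8_lattice (a i - a j)
    & forall i : 'I_3, E8_lattice (2 *: a i)].

Definition type_II1 (R : realType) (a0 a1 a2 : C8 R) : Prop :=
  perm_eq [seq dot (phi R) a | a <- frame_vectors a0 a1 a2]
          [:: 1; -1; 0; 0; 0; 0].

(* Values f(y +- z), read as the product f(y + z) f(y - z). *)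
Definition pm (R : realType) (T : zmodType) (f : T -> R[i]) (y z : T) : R[i] :=
  f (y + z) * f (y - z).

(* [(a +- b | x)] *)
Definition brpm (R : realType) (br : R[i] -> R[i]) (a b x : C8 R) : R[i] :=
  pm br (dot a x) (dot b x).

Definition entire (R : realType) (f : R[i] -> R[i]) : Prop :=
  forall z, derivable f z 1.

Definition three_term (R : realType) (br : R[i] -> R[i]) : Prop :=
  forall z alpha beta gamma : R[i],
    pm br beta gamma * pm br z alpha + pm br gamma alpha * pm br z beta
      + pm br alpha beta * pm br z gamma = 0.

(* The sets D on which functions live below are hyperplanes or disjoint unions
   of hyperplanes dot phi x = kappa, with kappa in a discrete set; they are
   closed complex submanifolds of C^8.  A meromorphic function on D is
   represented by a total function on C^8 whose values outside D and on its
   polar set carry no information.  Accordingly, an identity between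
   meromorphic functions on D is required to hold on a relatively open dense
   subset of D. *)
Definition generically (R : realType) (D : set (C8 R)) (Q : C8 R -> Prop) : Prop :=
  exists U : set (C8 R),
    [/\ open U, D `<=` closure (D `&` U) & forall x, D x -> U x -> Q x].

Definition holomorphic_on (R : realType) (U : set (C8 R)) (f : C8 R -> R[i]) : Prop :=
  forall x, U x -> differentiable f x.

(* Locally on D, f is a quotient p / q of holomorphic functions, q not being
   identically zero on any nonempty relatively open subset of D.  Holomorphic
   functions on the submanifold D are locally the restrictions of holomorphic
   functions on open subsets of C^8. *)
Definition meromorphic_on (R : realType) (D : set (C8 R)) (f : C8 R -> R[i]) : Prop :=
  forall x0, D x0 -> exists (U : set (C8 R)) (p q : C8 R -> R[i]),
    [/\ open U /\ U x0,
        holomorphic_on U p /\ holomorphic_on U q,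
        D `&` U `<=` closure (D `&` U `&` [set x | q x != 0])
      & forall x, D x -> U x -> q x != 0 -> f x = p x / q x].

Definition nonzero_meromorphic_on (R : realType) (D : set (C8 R))
    (f : C8 R -> R[i]) : Prop :=
  meromorphic_on D f /\ ~ generically D (fun x => f x = 0).

Definition D_ (R : realType) (omega delta : R[i]) : set (C8 R) :=
  \bigcup_(n in [set: int]) hyperplane (omega + n%:~R * delta).

Definition meromorphic_ORG_tau (R : realType) (br : R[i] -> R[i]) (delta : R[i])
    (D : set (C8 R)) (tau : C8 R -> R[i]) : Prop :=
  [/\ [set x + delta *: p | x in D & p in @E8_lattice R] = D,
      meromorphic_on D tau
    & forall a b c : C8 R, C3_frame a b c ->
      generically
        [set x | forall v, v \in frame_vectors a b c -> D (x + delta *: v)]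
        (fun x => brpm br b c x * pm tau x (delta *: a)
                + brpm br c a x * pm tau x (delta *: b)
                + brpm br a b x * pm tau x (delta *: c) = 0)].

Definition hypergeometric_tau (R : realType) (br : R[i] -> R[i])
    (omega delta : R[i]) (tau : C8 R -> R[i]) : Prop :=
  [/\ meromorphic_ORG_tau br delta (D_ omega delta) tau,
      forall n : int, n < 0 ->
        generically (hyperplane (omega + n%:~R * delta)) (fun x => tau x = 0)
    & ~ generically (hyperplane omega) (fun x => tau x = 0)].

Definition psi_entry (R : realType) (delta : R[i]) (a0 a1 a2 : C8 R)
    (psi : C8 R -> R[i]) (n i j : nat) (x : C8 R) : R[i] :=
  psi (x - ((n%:R - 1) * delta) *: a0
         + ((n%:R + 1 - i%:R - j%:R) * delta) *: a1
         + ((j%:R - i%:R) * delta) *: a2).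

(* The row and column indices of the determinant run over 1, ..., n. *)
Definition casorati (R : realType) (delta : R[i]) (a0 a1 a2 : C8 R)
    (psi : C8 R -> R[i]) (n : nat) (x : C8 R) : R[i] :=
  \det (\matrix_(i < n, j < n) psi_entry delta a0 a1 a2 psi n i.+1 j.+1 x).

Definition gauge_factors (R : realType) (br : R[i] -> R[i]) (omega delta : R[i])
    (a0 a1 a2 : C8 R) (tau0 g1 : C8 R -> R[i]) (g : nat -> C8 R -> R[i]) : Prop :=
  [/\ forall n, nonzero_meromorphic_on (hyperplane (omega + n%:R * delta)) (g n),
      generically (hyperplane omega) (fun x => g 0%N x = tau0 x),
      generically (hyperplane (omega + delta)) (fun x => g 1%N x = g1 x)
    & forall n : nat, (0 < n)%N ->
      generically (hyperplane (omega + n%:R * delta)) (fun x =>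
        g n.-1 (x - delta *: a0) * g n.+1 (x + delta *: a0) / pm (g n) x (delta *: a1)
        = brpm br a0 a2 x / brpm br a1 a2 x)].

(* Main.v *)
Require Import Defs.
From HB Require Import structures.
From mathcomp Require Import all_boot all_order all_algebra.
From mathcomp Require Import complex.
From mathcomp Require Import all_classical all_reals all_analysis.
From mathcomp Require Import ring lra.
From mathcomp Require Import perm.
Import Order.TTheory GRing.Theory Num.Theory.
Import numFieldNormedType.Exports.
Local Open Scope classical_set_scope.
Local Open Scope complex_scope.
Local Open Scope ring_scope.

(** Why the theorem holds.  Write [H n] for the hyperplane
[(phi|x) = omega + n delta] and [u, v, w] for [delta a0, delta a1, delta a2].

The gauge factors are defined by solving their recursion for the factor of
highest index.  Two properties are carried along the recursion: [g n] is
meromorphic and generically nonzero on [H n] ([gauge_mero]), and the quotient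
[g n (x +- v) / g n (x +- w)] equals [[(a0 +- a1|x)] / [(a0 +- a2|x)]] not only
for [n = 0, 1] but for all [n] ([gauge_ratio]).  Given this, the Desnanot-Jacobi
identity for the Casorati determinants ([casorati_jacobi]) says that
[g n * K n] satisfies the bilinear relation which [tau] satisfies for the frame
[a0, a1, a2] ([tau_bilinear]); that relation expresses [tau (x + u)] on [H n.+2]
by the values of [tau] on [H n.+1] and by [tau (x - u)] on [H n], through a
division by the latter ([tau_casorati]).

The division needs that [tau] vanishes identically on no [H n] with [0 <= n]
([tau_neq0]).  If [tau] vanishes on [H n.+2] and not on [H n.+1], then the
bilinear relations for the two frames [a0, a1, a2] and [phi - a0, a1, a2] become
two homogeneous linear equations for [tau (x +- v)] and [tau (x +- w)]; by the
three-term relation of [br] their determinant is, up to sign,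
[[omega + n.+1 delta] [(phi - 2 a0|x)] [(a1 +- a2|x)]].  This is not zero:
the zeros of [br] are closed under differences ([br_zero_sub]), [omega] is a
zero, and no nonzero multiple of [delta] is.

Finally, not identically zero has to mean generically nonzero: a meromorphic
function on a hyperplane is generically zero or generically nonzero
([meromorphic_dichotomy]).  This reduces, along complex lines, to unique
continuation for complex differentiable functions of one variable
([unique_continuation_disc]).  The latter comes from Goursat's theorem for
squares.  If [f] vanishes near 0, then [F z = f z / z ^+ N] is differentiable,
and so is [(F z - F w) ^+ 2 / (z - w)], even at [w].  Expanding the boundary
integral of the latter, which is zero, bounds [|F w|] by the maximum of [|F|] on
the boundary of the square, with a constant that does not depend on [N]; as [w]
is closer to 0 than the boundary, [N -> oo] gives [f w = 0]. *)

Set Implicit Arguments.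
Unset Strict Implicit.
Unset Printing Implicit Defensive.

(** * The complex modulus and differentiability *)

Section ComplexNorm.
Variable R : realType.
Implicit Types (z w : R[i]).

(** The modulus as an element of [R]; the norm of [R[i]] takes its values in
[R[i]], where the order is only partial. *)
Definition nrm (z : R[i]) : R := Normc.normc z.

Lemma normcE_nrm z : `|z| = (nrm z)%:C.
Proof. by []. Qed.

Lemma nrm_ge0 z : 0 <= nrm z.
Proof. by case: z => a b; exact: sqrtr_ge0. Qed.

Lemma nrm0 : nrm 0 = 0. Proof. exact: Normc.normc0. Qed.

Lemma nrmM z w : nrm (z * w) = nrm z * nrm w.
Proof. exact: Normc.normcM. Qed.

Lemma nrmV z : nrm z^-1 = (nrm z)^-1.
Proof. exact: Normc.normcV. Qed.

Lemma nrmX z n : nrm (z ^+ n) = nrm z ^+ n.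
Proof. by elim: n => [|n IH]; rewrite ?exprS ?nrmM ?IH// expr0 [nrm _]Normc.normc1. Qed.

Lemma nrmN z : nrm (- z) = nrm z. Proof. exact: normcN. Qed.

Lemma nrmD z w : nrm (z + w) <= nrm z + nrm w.
Proof. exact: le_normcD. Qed.

Lemma nrmB z w : nrm (z - w) <= nrm z + nrm w.
Proof. by rewrite -(nrmN w); exact: nrmD. Qed.

Lemma nrm_sub z w : nrm (z - w) = nrm (w - z).
Proof. by rewrite -nrmN opprB. Qed.

Lemma nrm_eq0 z : nrm z = 0 -> z = 0. Proof. exact: Normc.eq0_normc. Qed.

Lemma nrm_gt0 z : z != 0 -> 0 < nrm z.
Proof.
move=> z0; rewrite lt_def nrm_ge0 andbT; apply: contra z0 => /eqP h.
by rewrite (nrm_eq0 h).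
Qed.

Lemma nrm_real (x : R) : nrm x%:C = `|x|.
Proof. by rewrite /nrm /Normc.normc/= expr0n/= addr0 sqrtr_sqr. Qed.

Lemma nrm_i : nrm 'i = 1.
Proof. by rewrite /nrm /Normc.normc/= expr0n/= add0r expr1n sqrtr1. Qed.

Lemma Re_le_nrm z : `|complex.Re z| <= nrm z.
Proof.
case: z => a b; rewrite /nrm/= -sqrtr_sqr ler_sqrt ?addr_ge0 ?sqr_ge0//.
by rewrite lerDl sqr_ge0.
Qed.

Lemma Im_le_nrm z : `|complex.Im z| <= nrm z.
Proof.
case: z => a b; rewrite /nrm/= -sqrtr_sqr ler_sqrt ?addr_ge0 ?sqr_ge0//.
by rewrite lerDr sqr_ge0.
Qed.

Lemma nrm_le_ReIm z : nrm z <= `|complex.Re z| + `|complex.Im z|.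
Proof.
have -> : z = (complex.Re z)%:C + 'i * (complex.Im z)%:C.
  by case: z => a b; apply/eqP; rewrite eq_complex /=; apply/andP; split; apply/eqP; ring.
apply: (le_trans (nrmD _ _)); rewrite nrmM nrm_i mul1r !nrm_real /=.
by rewrite !(mulr0, mul0r, mulr1, mul1r, addr0, add0r, subr0).
Qed.

Lemma nbhs_nrmP z (A : set R[i]) :
  nbhs z A <-> exists2 e : R, 0 < e & forall w, nrm (w - z) < e -> A w.
Proof.
split.
  move=> /nbhs_normP[e /= e0 h]; exists (complex.Re e).
    by move: e0; rewrite ltcE => /andP[].
  move=> w hw; apply: h; rewrite /ball_/= distrC normcE_nrm.
  by move: e0 hw; case: e => a b; rewrite !ltcE/= => /andP[/eqP -> _] ->; rewrite eqxx.
move=> [e e0 h]; apply/nbhs_normP; exists e%:C => /=; first by rewrite ltcR.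
by move=> w; rewrite /ball_/= distrC normcE_nrm ltcR => /h.
Qed.

(** Complex differentiability at [z], with real tolerances *)
Definition cdiff (f : R[i] -> R[i]) z := exists l, forall e : R, 0 < e ->
  exists2 d : R, 0 < d & forall w, nrm (w - z) < d ->
    nrm (f w - f z - l * (w - z)) <= e * nrm (w - z).

Lemma derivable_cdiff f z : derivable f z 1 -> cdiff f z.
Proof.
move=> /cvg_ex[/= l]; rewrite /cdiff => /cvgrPdist_lt H.
exists l => e e0.
have /H : 0 < e%:C by rewrite ltcR.
rewrite near_withinE => /nbhs_nrmP[d d0 hd]; exists d => // w wz.
have [->|wz0] := eqVneq w z; first by rewrite !subrr mulr0 subr0 nrm0 mulr0.
have wz1 : w - z != 0 by rewrite subr_eq0.
have := hd (w - z); rewrite subr0 => /(_ wz wz1).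
rewrite normcE_nrm ltcR /= => /ltW.
rewrite (nrm_sub l); set t := (X in nrm X); have -> : t = (w - z)^-1 * (f w - f z - l * (w - z)).
  rewrite /t [_ *: 1]mulr1 /= subrK /GRing.scale/= [RHS]mulrBr.  rewrite [X in _ = _ - X]mulrCA.  by rewrite mulVf ?mulr1 ?subr_eq0//.
rewrite nrmM nrmV mulrC ler_pdivrMr//; exact: nrm_gt0.
Qed.

Lemma cdiff_cont f z : cdiff f z -> forall e : R, 0 < e ->
  exists2 d : R, 0 < d & forall w, nrm (w - z) < d -> nrm (f w - f z) < e.
Proof.
move=> [l H] e e0; have [d d0 hd] := H 1 ltr01.
have k0 : 0 < nrm l + 1 by rewrite ltr_wpDl ?nrm_ge0.
exists (Num.min d (e / (nrm l + 1))); first by rewrite lt_min d0 divr_gt0.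
move=> w; rewrite lt_min => /andP[/hd h1].
rewrite ltr_pdivlMr// mulrDr mulr1 => h2.
have -> : f w - f z = (f w - f z - l * (w - z)) + l * (w - z) by ring.
apply: le_lt_trans (nrmD _ _) _; rewrite nrmM.
lra.
Qed.

End ComplexNorm.

(** * Integrals over segments *)

Section SegmentIntegral.
Variable R : realType.
Implicit Types (h k : R -> R[i]) (a b c x y : R).
Local Notation mu := (@lebesgue_measure R).
Local Notation Re := (@complex.Re R).
Local Notation Im := (@complex.Im R).

(** Two-sided continuity at every point of the segment from [a] to [b] *)
Definition segment_continuous h a b := forall x, a <= x <= b ->
  forall e : R, 0 < e ->
  exists2 d : R, 0 < d & forall y, `|y - x| < d -> nrm (h y - h x) < e.

(** The integral over a segment of a complex-valued function of a real variable *)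
Definition cint h a b : R[i] :=
  (\int[mu]_(x in `[a, b]) Re (h x)) +i* (\int[mu]_(x in `[a, b]) Im (h x)).

Lemma segment_continuous_cst (u : R[i]) a b : segment_continuous (fun=> u) a b.
Proof. by move=> x _ e e0; exists 1 => // y _; rewrite subrr nrm0. Qed.

Lemma segment_continuous_lin h k (u : R[i]) a b :
  segment_continuous h a b -> segment_continuous k a b ->
  segment_continuous (fun x => u * h x + k x) a b.
Proof.
move=> hc kc x xab e e0.
have u0 : 0 < nrm u + 1 by rewrite ltr_wpDl ?nrm_ge0.
have [d d0 hd] := hc x xab (e / 2 / (nrm u + 1)) ltac:(by rewrite !divr_gt0).
have [d' d0' hd'] := kc x xab (e / 2) ltac:(by rewrite divr_gt0).
exists (Num.min d d'); first by rewrite lt_min d0.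
move=> y; rewrite lt_min => /andP[/hd h1 /hd' h2].
have -> : u * h y + k y - (u * h x + k x) = u * (h y - h x) + (k y - k x) by ring.
apply: le_lt_trans (nrmD _ _) _; rewrite nrmM.
rewrite ltr_pdivlMr// in h1.
have := nrm_ge0 (h y - h x); have := nrm_ge0 u; nra.
Qed.

Lemma Re_integrable h a b : segment_continuous h a b ->
  mu.-integrable `[a, b] (EFin \o (Re \o h)).
Proof.
move=> hc; apply: continuous_compact_integrable; first exact: segment_compact.
apply: continuous_in_subspaceT => x; rewrite inE/= in_itv/= => xab.
apply/cvgrPdist_lt => e e0; have [d d0 hd] := hc x xab e e0.
apply/nbhs_normP; exists d => // y; rewrite /ball_/= distrC => /hd; rewrite nrm_sub.
by apply: le_lt_trans; rewrite -raddfB; exact: Re_le_nrm.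
Qed.

Lemma Im_integrable h a b : segment_continuous h a b ->
  mu.-integrable `[a, b] (EFin \o (Im \o h)).
Proof.
move=> hc; apply: continuous_compact_integrable; first exact: segment_compact.
apply: continuous_in_subspaceT => x; rewrite inE/= in_itv/= => xab.
apply/cvgrPdist_lt => e e0; have [d d0 hd] := hc x xab e e0.
apply/nbhs_normP; exists d => // y; rewrite /ball_/= distrC => /hd; rewrite nrm_sub.
by apply: le_lt_trans; rewrite -raddfB; exact: Im_le_nrm.
Qed.

Let Rint_cst (m : R) a b : a <= b -> \int[mu]_(x in `[a, b]) m = m * (b - a).
Proof.
move=> ab; rewrite Rintegral_cst//; congr (_ * _).
have E : mu `[a, b] = (if (a < b)%R then (b - a)%:E else 0%E).
  by rewrite lebesgue_measure_itv/= lte_fin EFinB.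
apply: (etrans (congr1 fine E)).
by move: ab {E}; rewrite le_eqVlt => /predU1P[->|->]//; rewrite ltxx subrr.
Qed.

Lemma cint_lin h k (u : R[i]) a b :
  segment_continuous h a b -> segment_continuous k a b ->
  cint (fun x => u * h x + k x) a b = u * cint h a b + cint k a b.
Proof.
move=> hc kc.
have hr := Re_integrable hc; have hi := Im_integrable hc.
have kr := Re_integrable kc; have ki := Im_integrable kc.
case: u => p q.
have zl (r : R) (f : R -> R) : mu.-integrable `[a, b] (EFin \o f) ->
   mu.-integrable `[a, b] (EFin \o (fun x => r * f x)).
  by move=> fi; apply/(integrableZl _ r fi).
apply/eqP; rewrite eq_complex; apply/andP; split; apply/eqP => /=.
  rewrite -!RintegralZl// -RintegralB//; [|exact: zl..].
  rewrite -RintegralD//; last by apply: (integrableB _ (zl _ _ hr) (zl _ _ hi)).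
  by apply: eq_Rintegral => x _; case: (h x); case: (k x).
rewrite -!RintegralZl// -RintegralD//; [|exact: zl..].
rewrite -RintegralD//; last by apply: (integrableD _ (zl _ _ hi) (zl _ _ hr)).
by apply: eq_Rintegral => x _; case: (h x); case: (k x).
Qed.

Lemma eq_cint h k a b : (forall x, a <= x <= b -> h x = k x) ->
  cint h a b = cint k a b.
Proof.
by move=> hk; congr (_ +i* _); apply: eq_Rintegral => x; rewrite inE/= in_itv/= => /hk ->.
Qed.

Lemma cint_cst (u : R[i]) a b : a <= b -> cint (fun=> u) a b = u * (b - a)%:C.
Proof.
move=> ab; case: u => p q; by rewrite /cint/= !Rint_cst//; simpc.
Qed.

Lemma cint_split h a b c : a <= c -> c <= b -> segment_continuous h a b ->
  cint h a b = cint h a c + cint h c b.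
Proof.
move=> ac cb hc.
have H (f : R -> R) : mu.-integrable `[a, b] (EFin \o f) ->
  \int[mu]_(x in `[a, b]) f x =
    \int[mu]_(x in `[a, c]) f x + \int[mu]_(x in `[c, b]) f x.
  move=> fi; rewrite -(Rintegral_itv_obnd_cbnd (r := c)).
    by rewrite -(Rintegral_itvB fi) ?bnd_simp// addrC subrK.
  apply: integrableS fi => //=.
  by apply: subset_itv; rewrite bnd_simp//.
rewrite /cint; simpc; congr (_ +i* _).
  exact: (H _ (Re_integrable hc)).
exact: (H _ (Im_integrable hc)).
Qed.

Lemma cint_bound h a b (M : R) : a <= b -> segment_continuous h a b ->
  (forall x, a <= x <= b -> nrm (h x) <= M) ->
  nrm (cint h a b) <= 2 * M * (b - a).
Proof.
move=> ab hc hM.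
have H (f : R -> R) : mu.-integrable `[a, b] (EFin \o f) ->
    (forall x, a <= x <= b -> `|f x| <= M) ->
  `|\int[mu]_(x in `[a, b]) f x| <= M * (b - a).
  move=> fi fM; apply: (le_trans (le_normr_Rintegral _ fi)) => //.
  rewrite -Rint_cst//.
  apply: le_Rintegral => //; first exact: integrable_norm.
    by apply: (Re_integrable (h := fun=> M%:C)); exact: segment_continuous_cst.
apply: (le_trans (nrm_le_ReIm _)) => /=.
rewrite (_ : 2 * M * (b - a) = M * (b - a) + M * (b - a)); last by ring.
apply: lerD.
  apply: H; first exact: (Re_integrable hc).
  by move=> x /hM; apply: le_trans; exact: Re_le_nrm.
apply: H; first exact: (Im_integrable hc).
by move=> x /hM; apply: le_trans; exact: Im_le_nrm.
Qed.

Lemma le_Re_cint h a b (m : R) : a <= b -> segment_continuous h a b ->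
  (forall x, a <= x <= b -> m <= Re (h x)) -> m * (b - a) <= Re (cint h a b).
Proof.
move=> ab hc hm /=.
rewrite -Rint_cst//.
apply: le_Rintegral => //.
- by apply: (Re_integrable (h := fun=> m%:C)); exact: segment_continuous_cst.
- exact: (Re_integrable hc).
Qed.

Lemma segment_bounded h a b : a <= b -> segment_continuous h a b ->
  exists M, forall x, a <= x <= b -> nrm (h x) <= M.
Proof.
move=> ab hc.
have cn : {within `[a, b], continuous (fun x => nrm (h x))}.
  apply: continuous_in_subspaceT => x; rewrite inE/= in_itv/= => xab.
  apply/cvgrPdist_lt => e e0; have [d d0 hd] := hc x xab e e0.
  apply/nbhs_normP; exists d => // y; rewrite /ball_/= distrC => /hd.
  apply: le_lt_trans; rewrite ler_norml; apply/andP; split.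
    rewrite lerBrDr addrC lerBlDl; apply: le_trans (nrmD _ _).
    by rewrite subrK.
  rewrite nrm_sub lerBlDl; apply: le_trans (nrmD _ _).
  by rewrite addrC subrK.
have [c _ hM] := EVT_max ab cn.
by exists (nrm (h c)) => x xab; apply: hM; rewrite in_itv.
Qed.

End SegmentIntegral.

(** * Goursat's theorem *)

Section Bisection.
Variable R : realType.
Implicit Types (a c s x y : R).

Lemma nested_segments (u l : nat -> R) :
  (forall n, 0 <= l n) -> (forall n, u n <= u n.+1) ->
  (forall n, u n.+1 + l n.+1 <= u n + l n) ->
  exists x, forall n, u n <= x <= u n + l n.
Proof.
move=> l0 ui ud.
have um m n : (m <= n)%N -> u m <= u n.
  move=> /subnK <-; elim: (n - m)%N => [|k IH]; first by rewrite add0n.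
  by rewrite addSn; exact: le_trans IH (ui _).
have dm m n : (m <= n)%N -> u n + l n <= u m + l m.
  move=> /subnK <-; elim: (n - m)%N => [|k IH]; first by rewrite add0n.
  by rewrite addSn; exact: le_trans (ud _) IH.
have ub m n : u m <= u n + l n.
  have [mn|/ltnW nm] := leqP m n.
    by apply: (le_trans (um _ _ mn)); rewrite lerDl.
  by apply: le_trans (dm _ _ nm); rewrite lerDl.
exists (sup (range u)) => n; apply/andP; split.
  apply: ub_le_sup; last by exists n.
  by exists (u 0 + l 0) => _ [m _ <-].
apply: ge_sup; first by exists (u 0), 0%N.
by move=> _ [m _ <-].
Qed.

(** Cousin's principle for squares: a property of squares that passes from the
four quarters of a square to the square, and holds for all small squares around
any given point of it, holds for the square. *)
Lemma square_bisection (P : R -> R -> R -> Prop) a c s : 0 < s ->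
  (forall a' c' s', 0 < s' -> P a' c' (s' / 2) -> P (a' + s' / 2) c' (s' / 2) ->
     P a' (c' + s' / 2) (s' / 2) -> P (a' + s' / 2) (c' + s' / 2) (s' / 2) -> P a' c' s') ->
  (forall x y, a <= x <= a + s -> c <= y <= c + s ->
    exists2 d : R, 0 < d & forall a' c' s', 0 < s' < d ->
      a' <= x <= a' + s' -> c' <= y <= c' + s' -> P a' c' s') ->
  P a c s.
Proof.
move=> s0 Psub Ploc; apply: contrapT => nP.
pose T := (R * R * R)%type.
pose Q (t : T) := P t.1.1 t.1.2 t.2.
(* a quarter of the square for which P fails, if there is one *)
pose next (t : T) : T :=
  let: (a', c', s') := t in
  if ~~ `[< P a' c' (s' / 2) >] then (a', c', s' / 2) else
  if ~~ `[< P (a' + s' / 2) c' (s' / 2) >] then (a' + s' / 2, c', s' / 2) else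
  if ~~ `[< P a' (c' + s' / 2) (s' / 2) >] then (a', c' + s' / 2, s' / 2) else
  (a' + s' / 2, c' + s' / 2, s' / 2).
have nextP (t : T) : 0 < t.2 -> ~ Q t -> [/\ ~ Q (next t), (next t).2 = t.2 / 2,
    t.1.1 <= (next t).1.1 /\ (next t).1.1 + (next t).2 <= t.1.1 + t.2 &
    t.1.2 <= (next t).1.2 /\ (next t).1.2 + (next t).2 <= t.1.2 + t.2].
  case: t => [[a' c'] s'] /= s0' nQ.
  case: asboolP => [P1|P1] /=; last by split=> //=; lra.
  case: asboolP => [P2|P2] /=; last by split=> //=; lra.
  case: asboolP => [P3|P3] /=; last by split=> //=; lra.
  split=> //=; [|lra|lra].
  by move=> P4; apply: nQ; exact: Psub.
pose v n := iter n next (a, c, s).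
have vP n : ~ Q (v n) /\ (v n).2 = s / 2 ^+ n.
  elim: n => [|n [IH1 IH2]]; first by rewrite expr0 divr1.
  have [|H1 H2 _ _] := nextP (v n) _ IH1; first by rewrite IH2 divr_gt0 ?exprn_gt0.
  by split=> //; rewrite -[v n.+1]/(next (v n)) H2 IH2 exprSr invfM mulrA.
have v0 n : 0 < (v n).2 by rewrite (vP n).2 divr_gt0 ?exprn_gt0.
have vn n := nextP (v n) (v0 n) (vP n).1.
have [x hx] := @nested_segments (fun n => (v n).1.1) (fun n => (v n).2)
  (fun n => ltW (v0 n)) (fun n => let: And4 _ _ h _ := vn n in h.1)
  (fun n => let: And4 _ _ h _ := vn n in h.2).
have [y hy] := @nested_segments (fun n => (v n).1.2) (fun n => (v n).2)
  (fun n => ltW (v0 n)) (fun n => let: And4 _ _ _ h := vn n in h.1)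
  (fun n => let: And4 _ _ _ h := vn n in h.2).
have [d d0 hd] := Ploc x y (hx 0%N) (hy 0%N).
have [n hn] : exists n, s / 2 ^+ n < d.
  have [n hn] : exists n, s / d < n%:R :> R.
    by exists (Num.bound (s / d)); apply: archi_boundP; rewrite divr_ge0 ?ltW.
  exists n; rewrite ltr_pdivrMr ?exprn_gt0// mulrC -ltr_pdivrMr//.
  apply: lt_le_trans hn _; rewrite -natrX ler_nat; exact/ltnW/ltn_expl.
apply: (vP n).1; apply: hd; rewrite ?hx ?hy//.
by rewrite v0 (vP n).2.
Qed.

End Bisection.

Section Goursat.
Variable R : realType.
Implicit Types (f : R[i] -> R[i]) (a b c d s x y : R).

(** The integral of [f z dz] along the boundary, run counterclockwise, of the
rectangle with corners [a +i* c] and [b +i* d] *)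
Definition rectint f a b c d : R[i] :=
  cint (fun x => f (x +i* c)) a b - cint (fun x => f (x +i* d)) a b
  + 'i * (cint (fun y => f (b +i* y)) c d - cint (fun y => f (a +i* y)) c d).

(** [f] is continuous along each side of the rectangle. *)
Definition boundary_continuous f a b c d :=
  [/\ segment_continuous (fun x => f (x +i* c)) a b,
      segment_continuous (fun x => f (x +i* d)) a b,
      segment_continuous (fun y => f (b +i* y)) c d &
      segment_continuous (fun y => f (a +i* y)) c d].

(** [P] holds on the boundary of the rectangle. *)
Definition on_boundary a b c d (P : R[i] -> Prop) :=
  (forall x, a <= x <= b -> P (x +i* c) /\ P (x +i* d)) /\
  (forall y, c <= y <= d -> P (b +i* y) /\ P (a +i* y)).

Lemma nrm_hor x x' y : nrm ((x +i* y) - (x' +i* y)) = `|x - x'|.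
Proof. by rewrite -nrm_real; congr nrm; apply/eqP; rewrite eq_complex /= subrr !eqxx. Qed.

Lemma nrm_ver x y y' : nrm ((x +i* y) - (x +i* y')) = `|y - y'|.
Proof.
rewrite -nrm_real -[RHS]mul1r -nrm_i -nrmM; congr nrm; apply/eqP.
by rewrite eq_complex /= subrr !(mul0r, mul1r, mulr0, subr0, add0r, oppr0, addr0) !eqxx.
Qed.

Lemma hor_continuous f a b y : (forall x, a <= x <= b -> cdiff f (x +i* y)) ->
  segment_continuous (fun x => f (x +i* y)) a b.
Proof.
move=> df x xab e e0; have [d d0 hd] := cdiff_cont (df x xab) e0.
by exists d => // x' xx'; apply: hd; rewrite nrm_hor.
Qed.

Lemma ver_continuous f x c d : (forall y, c <= y <= d -> cdiff f (x +i* y)) ->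
  segment_continuous (fun y => f (x +i* y)) c d.
Proof.
move=> df y ycd e e0; have [r r0 hr] := cdiff_cont (df y ycd) e0.
by exists r => // y' yy'; apply: hr; rewrite nrm_ver.
Qed.

Lemma cdiff_boundary f a b c d : on_boundary a b c d (cdiff f) ->
  boundary_continuous f a b c d.
Proof.
move=> [h v]; split.
- by apply: hor_continuous => x /h[].
- by apply: hor_continuous => x /h[].
- by apply: ver_continuous => x /v[].
- by apply: ver_continuous => x /v[].
Qed.

Lemma rectint_lin f g (u : R[i]) a b c d :
  boundary_continuous f a b c d -> boundary_continuous g a b c d ->
  rectint (fun z => u * f z + g z) a b c d = u * rectint f a b c d + rectint g a b c d.
Proof.
move=> [f1 f2 f3 f4] [g1 g2 g3 g4]; rewrite /rectint !cint_lin//; ring.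
Qed.

Lemma eq_rectint f g a b c d : on_boundary a b c d (fun z => f z = g z) ->
  rectint f a b c d = rectint g a b c d.
Proof.
move=> [h v]; rewrite /rectint; congr (_ - _ + 'i * (_ - _)); apply: eq_cint.
- by move=> x /h[].
- by move=> x /h[].
- by move=> x /v[].
- by move=> x /v[].
Qed.

Lemma rectint_split f a b c d m n : a <= m <= b -> c <= n <= d ->
  (forall x y, a <= x <= b -> c <= y <= d -> cdiff f (x +i* y)) ->
  rectint f a b c d = rectint f a m c n + rectint f m b c n
                      + rectint f a m n d + rectint f m b n d.
Proof.
move=> /andP[am mb] /andP[cn nd] df.
have ab := le_trans am mb; have cd := le_trans cn nd.
have hc y : c <= y <= d -> segment_continuous (fun x => f (x +i* y)) a b.
  by move=> h; apply: hor_continuous => x xab; exact: df.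
have vc x : a <= x <= b -> segment_continuous (fun y => f (x +i* y)) c d.
  by move=> h; apply: ver_continuous => y ycd; exact: df.
rewrite /rectint (cint_split am mb (hc c _)) ?lexx//.
rewrite (cint_split am mb (hc d _)) ?lexx ?andbT//.
rewrite (cint_split cn nd (vc a _)) ?lexx//.
rewrite (cint_split cn nd (vc b _)) ?lexx ?andbT//.
ring.
Qed.

Lemma rectint_bound f a b c d (M : R) : a <= b -> c <= d ->
  boundary_continuous f a b c d -> on_boundary a b c d (fun z => nrm (f z) <= M) ->
  nrm (rectint f a b c d) <= 4 * M * (b - a) + 4 * M * (d - c).
Proof.
move=> ab cd [f1 f2 f3 f4] [h v].
have h1 := cint_bound ab f1 (fun x xab => (h x xab).1).
have h2 := cint_bound ab f2 (fun x xab => (h x xab).2).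
have h3 := cint_bound cd f3 (fun x xab => (v x xab).1).
have h4 := cint_bound cd f4 (fun x xab => (v x xab).2).
apply: (le_trans (nrmD _ _)); rewrite nrmM nrm_i mul1r.
apply: (le_trans (lerD (nrmB _ _) (nrmB _ _))).
by lra.
Qed.

(** On a square of side [s] around a point of differentiability, the constant
and linear parts of the Taylor expansion integrate to zero. *)
Lemma rectint_local f x y (e : R) : 0 < e -> cdiff f (x +i* y) ->
  exists2 r : R, 0 < r & forall a c s, 0 < s < r ->
    a <= x <= a + s -> c <= y <= c + s ->
    (forall x' y', a <= x' <= a + s -> c <= y' <= c + s -> cdiff f (x' +i* y')) ->
    nrm (rectint f a (a + s) c (c + s)) <= e * s ^+ 2.
Proof.
move=> e0 [l H]; have [r r0 hr] := H (e / 16) ltac:(by rewrite divr_gt0).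
exists (r / 2); first by rewrite divr_gt0.
move=> a c s /andP[s0 sr] xa yc df.
have aas : a <= a + s by rewrite lerDl ltW.
have ccs : c <= c + s by rewrite lerDl ltW.
have near x' y' : a <= x' <= a + s -> c <= y' <= c + s ->
    nrm (f (x' +i* y') - f (x +i* y) - l * (x' +i* y' - x +i* y)) <= e / 8 * s.
  move=> xa' yc'.
  have bnd : nrm (x' +i* y' - x +i* y) <= 2 * s.
    apply: (le_trans (nrm_le_ReIm _)) => /=; simpc => /=.
    have -> : 2 * s = s + s by ring.
    by apply: lerD; rewrite ler_norml; lra.
  apply: le_trans (hr _ _) _; first by apply: le_lt_trans bnd _; lra.
  have := ler_wpM2l (ltW (divr_gt0 e0 (ltr0Sn R 15))) bnd; lra.
pose h k x' := f (x' +i* k); pose v k y' := f (k +i* y').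
have hC k : c <= k <= c + s -> segment_continuous (h k) a (a + s).
  by move=> kk; apply: hor_continuous => x' xx'; exact: df.
have vC k : a <= k <= a + s -> segment_continuous (v k) c (c + s).
  by move=> kk; apply: ver_continuous => x' xx'; exact: df.
have cl : c <= c <= c + s by rewrite lexx.
have cr : c <= c + s <= c + s by rewrite lexx andbT.
have al : a <= a <= a + s by rewrite lexx.
have ar : a <= a + s <= a + s by rewrite lexx andbT.
have E1 : nrm (cint (h c) a (a + s) - cint (h (c + s)) a (a + s) + l * 'i * s%:C * s%:C) <= e / 2 * s ^+ 2.
  have Cc := @segment_continuous_cst R (l * 'i * s%:C) a (a + s).
  have Ch := segment_continuous_lin (-1) (hC _ cr) Cc.
  have -> : cint (h c) a (a + s) - cint (h (c + s)) a (a + s) + l * 'i * s%:C * s%:C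
    = cint (fun x' => 1 * h c x' + (-1 * h (c + s) x' + l * 'i * s%:C)) a (a + s).
    rewrite cint_lin ?cint_lin ?cint_cst//; try exact: hC.
    by rewrite [a + s]addrC addrK; ring.
  apply: le_trans (cint_bound aas (M := e / 4 * s) _ _) _.
  - by apply: segment_continuous_lin => //; exact: hC.
  - move=> x' xx'.
    have n1 := near x' c xx' cl; have n2 := near x' (c + s) xx' cr.
    have -> : 1 * h c x' + (-1 * h (c + s) x' + l * 'i * s%:C) =
      (f (x' +i* c) - f (x +i* y) - l * (x' +i* c - x +i* y)) -
      (f (x' +i* (c + s)) - f (x +i* y) - l * (x' +i* (c + s) - x +i* y)).
      rewrite /h; have -> : x' +i* (c + s) = x' +i* c + 'i * s%:C by simpc.
      by ring.
    by apply: le_trans (nrmB _ _) _; lra.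
  by rewrite [a + s]addrC addrK; lra.
have E2 : nrm (cint (v (a + s)) c (c + s) - cint (v a) c (c + s) - l * s%:C * s%:C) <= e / 2 * s ^+ 2.
  have Cc := @segment_continuous_cst R (- (l * s%:C)) c (c + s).
  have Ch := segment_continuous_lin (-1) (vC _ al) Cc.
  have -> : cint (v (a + s)) c (c + s) - cint (v a) c (c + s) - l * s%:C * s%:C
    = cint (fun x' => 1 * v (a + s) x' + (-1 * v a x' + - (l * s%:C))) c (c + s).
    rewrite cint_lin ?cint_lin ?cint_cst//; try exact: vC.
    by rewrite [c + s]addrC addrK; ring.
  apply: le_trans (cint_bound ccs (M := e / 4 * s) _ _) _.
  - by apply: segment_continuous_lin => //; exact: vC.
  - move=> y' yy'.
    have n1 := near (a + s) y' ar yy'; have n2 := near a y' al yy'.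
    have -> : 1 * v (a + s) y' + (-1 * v a y' + - (l * s%:C)) =
      (f ((a + s) +i* y') - f (x +i* y) - l * ((a + s) +i* y' - x +i* y)) -
      (f (a +i* y') - f (x +i* y) - l * (a +i* y' - x +i* y)).
      rewrite /v; have -> : (a + s) +i* y' = a +i* y' + s%:C by simpc.
      by ring.
    by apply: le_trans (nrmB _ _) _; lra.
  by rewrite [c + s]addrC addrK; lra.
have -> : rectint f a (a + s) c (c + s) =
  (cint (h c) a (a + s) - cint (h (c + s)) a (a + s) + l * 'i * s%:C * s%:C) +
  'i * (cint (v (a + s)) c (c + s) - cint (v a) c (c + s) - l * s%:C * s%:C).
  rewrite /rectint -/(h c) -/(h (c + s)) -/(v a) -/(v (a + s)); ring.
apply: le_trans (nrmD _ _) _; rewrite nrmM nrm_i; lra.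
Qed.

(** Goursat's theorem for squares: the boundary integral over a square of side
[s] is at most [e * s ^+ 2] for each [e > 0], by bisection. *)
Lemma goursat f a c s : 0 < s ->
  (forall x y, a <= x <= a + s -> c <= y <= c + s -> cdiff f (x +i* y)) ->
  rectint f a (a + s) c (c + s) = 0.
Proof.
move=> s0 df; apply: nrm_eq0; apply: le_anti; rewrite nrm_ge0 andbT.
suff H (e : R) : 0 < e -> nrm (rectint f a (a + s) c (c + s)) <= e * s ^+ 2.
  apply/ler_addgt0Pr => e e0; rewrite add0r.
  have := H (e / s ^+ 2) ltac:(by rewrite divr_gt0 ?exprn_gt0).
  by rewrite divfK// sqrf_eq0 gt_eqF.
move=> e0.
pose P a' c' s' := a <= a' -> a' + s' <= a + s -> c <= c' -> c' + s' <= c + s ->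
  nrm (rectint f a' (a' + s') c' (c' + s')) <= e * s' ^+ 2.
suff : P a c s by apply.
apply: square_bisection => //.
  move=> a' c' s' s0' P1 P2 P3 P4 aa ss cc tt.
  have -> : a' + s' = a' + s' / 2 + s' / 2 by field.
  have -> : c' + s' = c' + s' / 2 + s' / 2 by field.
  rewrite (@rectint_split f _ _ _ _ (a' + s' / 2) (c' + s' / 2)); last 3 first.
  - by lra.
  - by lra.
  - by move=> x y hx hy; apply: df; lra.
  have := P1 ltac:(lra) ltac:(lra) ltac:(lra) ltac:(lra).
  have := P2 ltac:(lra) ltac:(lra) ltac:(lra) ltac:(lra).
  have := P3 ltac:(lra) ltac:(lra) ltac:(lra) ltac:(lra).
  have := P4 ltac:(lra) ltac:(lra) ltac:(lra) ltac:(lra).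
  set q1 := rectint _ _ _ _ _; set q2 := rectint _ _ _ _ _.
  set q3 := rectint _ _ _ _ _; set q4 := rectint _ _ _ _ _ => h4 h3 h2 h1.
  apply: le_trans (nrmD _ _) _; apply: le_trans (lerD (nrmD _ _) (lexx _)) _.
  apply: le_trans (lerD (lerD (nrmD _ _) (lexx _)) (lexx _)) _.
  set E := e * (s' / 2) ^+ 2 in h1 h2 h3 h4.
  have -> : e * s' ^+ 2 = E + E + E + E by rewrite /E; field.
  exact: (lerD (lerD (lerD h1 h2) h3) h4).
move=> x y xa yc; have [r r0 hr] := rectint_local e0 (df x y xa yc).
exists r => // a' c' s' s0' xa' yc' aa ss cc tt; apply: hr => // x' y' hx hy.
by apply: df; lra.
Qed.

End Goursat.

(** * Unique continuation in one variable *)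

Section UniqueContinuation.
Variable R : realType.
Implicit Types (f g : R[i] -> R[i]) (z w : R[i]).
Local Notation Re := (@complex.Re R).
Local Notation Im := (@complex.Im R).

Lemma cdiff_near f g z (e : R) : 0 < e ->
  (forall w, nrm (w - z) < e -> g w = f w) -> cdiff f z -> cdiff g z.
Proof.
move=> e0 fg [l H]; exists l => d d0; have [r r0 hr] := H d d0.
exists (Num.min e r) => [|w]; first by rewrite lt_min e0.
by rewrite lt_min => /andP[/fg -> /hr]; rewrite fg// subrr nrm0.
Qed.

(** Where [f] is differentiable at [w], so is [(f z - f w)^2 / (z - w)]: the
square absorbs the pole. *)
Lemma cdiff_square_quotient f w : cdiff f w ->
  cdiff (fun z => (f z - f w) ^+ 2 / (z - w)) w.
Proof.
move=> [l H]; exists (l ^+ 2) => e e0.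
have k0 : 0 < 2 * nrm l + 1 by rewrite ltr_wpDl ?mulr_ge0 ?nrm_ge0.
have [d d0 hd] := H (Num.min 1 (e / (2 * nrm l + 1))) ltac:(by rewrite lt_min ltr01 divr_gt0).
exists d => // z zw; rewrite !subrr invr0 mulr0 subr0.
have [->|neq] := eqVneq z w; first by rewrite !subrr invr0 !(mulr0, subr0, nrm0).
have n0 : z - w != 0 by rewrite subr_eq0.
have := hd z zw; set E := (f z - f w - l * (z - w)) => hE.
have -> : (f z - f w) ^+ 2 / (z - w) - l ^+ 2 * (z - w) = 2 * l * E + E * E / (z - w).
  have -> : f z - f w = E + l * (z - w) by rewrite /E; ring.
  by field.
have p0 := nrm_gt0 n0.
have [h1 h2] : nrm E <= nrm (z - w) /\ nrm E * (2 * nrm l + 1) <= e * nrm (z - w).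
  split; first by apply: le_trans hE _; rewrite ler_piMl ?nrm_ge0// ge_min lexx.
  rewrite -ler_pdivlMr// mulrAC; apply: le_trans hE _.
  by apply: ler_wpM2r; [exact: nrm_ge0|rewrite ge_min lexx orbT].
have n2 : nrm 2 = 2 :> R.
  by rewrite -(rmorph_nat (real_complex R) 2) nrm_real ger0_norm.
apply: le_trans (nrmD _ _) _; rewrite !nrmM nrmV n2.
have : nrm E * nrm E / nrm (z - w) <= nrm E.
  by rewrite ler_pdivrMr// ler_wpM2l ?nrm_ge0.
lra.
Qed.

Lemma le_Re_cintZ (h : R -> R[i]) (u : R[i]) (a b m : R) : a <= b ->
  segment_continuous h a b -> (forall x, a <= x <= b -> m <= Re (u * h x)) ->
  m * (b - a) <= Re (u * cint h a b).
Proof.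
move=> ab hc hm.
have := cint_lin u hc (@segment_continuous_cst R 0 a b).
rewrite cint_cst// mul0r addr0 => <-; apply: le_Re_cint => //.
  exact: segment_continuous_lin (@segment_continuous_cst R 0 a b).
by move=> x /hm; rewrite addr0.
Qed.

Lemma nrm_square (r x y : R) : - r <= x <= r -> - r <= y <= r -> nrm (x +i* y) <= 2 * r.
Proof.
move=> hx hy; apply: le_trans (nrm_le_ReIm _) _ => /=.
by rewrite (_ : 2 * r = r + r); [apply: lerD; rewrite ler_norml|ring].
Qed.

Lemma nrm_square_boundary (r : R) : 0 < r ->
  on_boundary (- r) r (- r) r (fun z => r <= nrm z).
Proof.
move=> r0; split=> x _; split.
- by apply: le_trans (Im_le_nrm _); rewrite /= ler_normr opprK lexx orbT.
- by apply: le_trans (Im_le_nrm _); rewrite /= ler_normr lexx.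
- by apply: le_trans (Re_le_nrm _); rewrite /= ler_normr lexx.
- by apply: le_trans (Re_le_nrm _); rewrite /= ler_normr opprK lexx orbT.
Qed.

Lemma on_boundaryW (a b c d : R) (P Q : R[i] -> Prop) :
  (forall z, P z -> Q z) -> on_boundary a b c d P -> on_boundary a b c d Q.
Proof.
by move=> PQ [h v]; split=> [x /h[]|y /v[]] /PQ p /PQ q.
Qed.

Lemma on_boundary_and (a b c d : R) (P Q : R[i] -> Prop) :
  on_boundary a b c d P -> on_boundary a b c d Q ->
  on_boundary a b c d (fun z => P z /\ Q z).
Proof.
by move=> [h v] [h' v']; split=> [x xab|y ycd];
  [have [? ?] := h x xab; have [? ?] := h' x xab|
   have [? ?] := v y ycd; have [? ?] := v' y ycd].
Qed.

(** The winding number of the boundary of a square around an interior point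
does not vanish: each side contributes a positive amount to its imaginary part. *)
Lemma rectint_inv_neq0 (r : R) w : nrm w < r ->
  rectint (fun z => (z - w)^-1) (- r) r (- r) r != 0.
Proof.
move=> wr; have r0 : 0 < r := le_lt_trans (nrm_ge0 _) wr.
have rr : - r <= r by lra.
have hW : on_boundary (- r) r (- r) r (cdiff (fun z => (z - w)^-1)).
  apply: on_boundaryW (nrm_square_boundary r0) => z rz.
  apply: derivable_cdiff; apply: derivableV.
    by rewrite subr_eq0; apply: contraTneq rz => ->; rewrite -ltNge.
  by apply: derivableB; [exact: derivable_id|exact: derivable_cst].
have [c1 c2 c3 c4] := cdiff_boundary hW.
(* a point z of the boundary has |z - w| <= 3 r, and its distance to w across
   its side is at least r - |w| *)
set m := (r - nrm w) / (3 * r) ^+ 2.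
have m0 : 0 < m by rewrite divr_gt0 ?subr_gt0 ?exprn_gt0 ?mulr_gt0.
have key (p q t : R) : r - nrm w <= t -> 0 < p ^+ 2 + q ^+ 2 <= (3 * r) ^+ 2 ->
    m <= t / (p ^+ 2 + q ^+ 2).
  move=> h1 /andP[h2 h3]; rewrite /m ler_pdivlMr// mulrAC ler_pdivrMr ?exprn_gt0 ?mulr_gt0//.
  have d0 : 0 < r - nrm w by rewrite subr_gt0.
  apply: ler_pM => //; exact: ltW.
have sq (x y : R) : - r <= x <= r -> - r <= y <= r -> r <= nrm (x +i* y) ->
   let z := x +i* y - w in 0 < (Re z) ^+ 2 + (Im z) ^+ 2 <= (3 * r) ^+ 2.
  move=> hx hy hz /=.
  have -> : Re (x +i* y - w) ^+ 2 + Im (x +i* y - w) ^+ 2 = nrm (x +i* y - w) ^+ 2.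
    by case: (x +i* y - w) => p q; rewrite /nrm/= sqr_sqrtr// addr_ge0 ?sqr_ge0.
  rewrite exprn_gt0/=; last first.
    by apply: nrm_gt0; rewrite subr_eq0; apply: contraTneq hz => ->; rewrite -ltNge.
  rewrite ler_sqr ?nnegrE ?nrm_ge0 ?mulr_ge0 ?(ltW r0)//.
  by apply: le_trans (nrmB _ _) _; have := nrm_square hx hy; lra.
have [hh vv] := nrm_square_boundary r0.
have := Re_le_nrm w; have := Im_le_nrm w; rewrite !ler_norml => /andP[iw iw'] /andP[rw rw'].
have lr : - r <= - r <= r by lra.
have rl : - r <= r <= r by lra.
have H1 := @le_Re_cintZ _ (- 'i) _ _ m rr c1.
have H2 := @le_Re_cintZ _ 'i _ _ m rr c2.
have H3 := @le_Re_cintZ _ 1 _ _ m rr c3.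
have H4 := @le_Re_cintZ _ (- 1) _ _ m rr c4.
have : 0 < Re (- 'i * rectint (fun z => (z - w)^-1) (- r) r (- r) r).
  have -> : - 'i * rectint (fun z => (z - w)^-1) (- r) r (- r) r =
    - 'i * cint (fun x => (x +i* - r - w)^-1) (- r) r +
    'i * cint (fun x => (x +i* r - w)^-1) (- r) r +
    1 * cint (fun y => (r +i* y - w)^-1) (- r) r +
    - 1 * cint (fun y => ((- r) +i* y - w)^-1) (- r) r.
    rewrite /rectint mulrDr [- 'i * ('i * _)]mulrA (_ : - 'i * 'i = 1); last by simpc.
    by ring.
  have ReD u v : Re (u + v) = Re u + Re v by case: u; case: v.
  rewrite !ReD.
  have q0 : 0 < m * (r - - r) by rewrite mulr_gt0//; lra.
  have RI z : [/\ Re (- 'i * z^-1) = - Im z / (Re z ^+ 2 + Im z ^+ 2),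
      Re ('i * z^-1) = Im z / (Re z ^+ 2 + Im z ^+ 2),
      Re (1 * z^-1) = Re z / (Re z ^+ 2 + Im z ^+ 2) &
      Re (- 1 * z^-1) = - Re z / (Re z ^+ 2 + Im z ^+ 2)].
    by case: z => p q; split=> /=; ring.
  have S1 : m * (r - - r) <= Re (- 'i * cint (fun x => (x +i* - r - w)^-1) (- r) r).
    apply: H1 => x hx; have [-> _ _ _] := RI (x +i* - r - w).
    apply: key (sq x _ hx lr (hh _ hx).1); rewrite raddfB /=; lra.
  have S2 : m * (r - - r) <= Re ('i * cint (fun x => (x +i* r - w)^-1) (- r) r).
    apply: H2 => x hx; have [_ -> _ _] := RI (x +i* r - w).
    apply: key (sq x _ hx rl (hh _ hx).2); rewrite raddfB /=; lra.
  have S3 : m * (r - - r) <= Re (1 * cint (fun y => (r +i* y - w)^-1) (- r) r).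
    apply: H3 => y hy; have [_ _ -> _] := RI (r +i* y - w).
    apply: key (sq _ y rl hy (vv _ hy).1); rewrite raddfB /=; lra.
  have S4 : m * (r - - r) <= Re (- 1 * cint (fun y => ((- r) +i* y - w)^-1) (- r) r).
    apply: H4 => y hy; have [_ _ _ ->] := RI ((- r) +i* y - w).
    apply: key (sq _ y lr hy (vv _ hy).2); rewrite raddfB /=; lra.
  have p s : m * (r - - r) <= s -> 0 < s by exact: lt_le_trans.
  exact: (addr_gt0 (addr_gt0 (addr_gt0 (p _ S1) (p _ S2)) (p _ S3)) (p _ S4)).
by move=> h; apply/eqP => h0; rewrite h0 mulr0 ltxx in h.
Qed.

End UniqueContinuation.

Section UniqueContinuationDisc.
Variable R : realType.
Implicit Types (f g : R[i] -> R[i]) (z w : R[i]).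

Lemma derivable_power f z n : derivable f z 1 -> derivable (fun z => f z ^+ n) z 1.
Proof.
move=> df; elim: n => [|n IH].
  have -> : (fun z => f z ^+ 0) = cst 1 by apply/funext => u; rewrite expr0.
  exact: derivable_cst.
have -> : (fun z => f z ^+ n.+1) = (fun z => f z * f z ^+ n).
  by apply/funext => u; rewrite exprS.
exact: (derivableM df IH).
Qed.

(** The estimate behind unique continuation: for [F z = f z / z ^+ N], the
identity [rectint ((F z - F w)^2 / (z - w)) = 0] bounds [F w] by the values of
[F] on the boundary of the square of side [2 r] centred at 0. *)
Lemma cauchy_estimate f (r e : R) w (N : nat) : 0 < e -> e <= nrm w < r ->
  (forall z, nrm z < 4 * r -> derivable f z 1) ->
  (forall z, nrm z < e -> f z = 0) ->
  let F z := f z / z ^+ N in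
  [/\ boundary_continuous (fun z => F z / (z - w)) (- r) r (- r) r,
      boundary_continuous (fun z => F z ^+ 2 / (z - w)) (- r) r (- r) r &
  F w ^+ 2 * rectint (fun z => (z - w)^-1) (- r) r (- r) r =
  2 * F w * rectint (fun z => F z / (z - w)) (- r) r (- r) r
  - rectint (fun z => F z ^+ 2 / (z - w)) (- r) r (- r) r].
Proof.
move=> e0 /andP[ew wr] df f0 F.
have r0 : 0 < r := le_lt_trans (nrm_ge0 _) wr.
have dF z : nrm z < 4 * r -> z != 0 -> derivable F z 1.
  move=> zr z0; apply: derivableM; first exact: df.
  apply: derivableV; first by rewrite expf_neq0.
  by apply: derivable_power; exact: derivable_id.
have dk z : z != w -> derivable (fun z => (z - w)^-1) z 1.
  move=> zw; apply: derivableV; first by rewrite subr_eq0.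
  by apply: derivableB; [exact: derivable_id|exact: derivable_cst].
have dg z : nrm z < 4 * r -> cdiff (fun z => (F z - F w) ^+ 2 / (z - w)) z.
  move=> zr; have [->|zw] := eqVneq z w.
    apply: cdiff_square_quotient; apply: derivable_cdiff; apply: dF; first by lra.
    by apply/eqP => w0; move: ew; rewrite w0 nrm0; lra.
  have [->|z0] := eqVneq z 0.
    apply: (@cdiff_near R (fun z => (F w) ^+ 2 / (z - w)) _ _ e) => //.
      by move=> u; rewrite subr0 => /f0; rewrite /F => ->; rewrite mul0r sub0r sqrrN.
    apply: derivable_cdiff; apply: derivableM; first exact: derivable_cst.
    apply: dk; apply/eqP => w0; move: ew; rewrite -w0 nrm0; lra.
  apply: derivable_cdiff; apply: derivableM; last exact: dk.
  by apply: derivable_power; apply: derivableB; [exact: dF|exact: derivable_cst].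
have G : rectint (fun z => (F z - F w) ^+ 2 / (z - w)) (- r) r (- r) r = 0.
  have rE : r = - r + 2 * r by ring.
  rewrite [X in rectint _ _ X](rE) [X in rectint _ _ _ _ X](rE).
  apply: goursat; first by lra.
  move=> x y hx hy; apply: dg; apply: le_lt_trans (@nrm_square _ r _ _ _ _) _; lra.
have B1 : boundary_continuous (fun z => (z - w)^-1) (- r) r (- r) r.
  apply: cdiff_boundary; apply: on_boundaryW (nrm_square_boundary r0) => z rz.
  apply: derivable_cdiff; apply: dk.
  by apply: contraTneq rz => ->; rewrite -ltNge.
have hb : on_boundary (- r) r (- r) r (fun z => [/\ z != 0, z != w & nrm z < 4 * r]).
  have rl : - r <= - r <= r by lra.
  have rr : - r <= r <= r by lra.
  have H z : r <= nrm z /\ nrm z <= 2 * r -> [/\ z != 0, z != w & nrm z < 4 * r].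
    move=> [h1 h2]; split; last by lra.
      by apply: contraTneq h1 => ->; rewrite nrm0 -ltNge.
    by apply: contraTneq h1 => ->; rewrite -ltNge.
  apply: on_boundaryW H _; apply: on_boundary_and; first exact: nrm_square_boundary.
  by split=> [x hx|y hy]; split; apply: nrm_square.
have B2 : boundary_continuous (fun z => F z / (z - w)) (- r) r (- r) r.
  apply: cdiff_boundary; apply: on_boundaryW hb => z [z0 zw zr].
  by apply: derivable_cdiff; apply: derivableM; [exact: dF|exact: dk].
have B3 : boundary_continuous (fun z => F z ^+ 2 / (z - w)) (- r) r (- r) r.
  apply: cdiff_boundary; apply: on_boundaryW hb => z [z0 zw zr].
  by apply: derivable_cdiff; apply: derivableM; [apply: derivable_power; exact: dF|exact: dk].
have B4 : boundary_continuous (fun z => - 2 * F w * (F z / (z - w)) + F z ^+ 2 / (z - w)) (- r) r (- r) r.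
  case: B2 => [a1 a2 a3 a4]; case: B3 => [b1 b2 b3 b4].
  by split; exact: segment_continuous_lin.
split=> //.
have : rectint (fun z => F w ^+ 2 * (z - w)^-1 +
    (- 2 * F w * (F z / (z - w)) + F z ^+ 2 / (z - w))) (- r) r (- r) r = 0.
  rewrite -[RHS]G; apply: eq_rectint; apply: on_boundaryW hb => z _; ring.
rewrite rectint_lin// rectint_lin// => /eqP; rewrite addr_eq0 => /eqP ->; ring.
Qed.

Lemma expr_lt_eps (q e : R) : 0 <= q < 1 -> 0 < e -> exists n, q ^+ n < e.
Proof.
move=> /andP[q0 q1] e0.
have /cvg_expr/cvgrPdist_lt/(_ e e0)[n _ hn] : `|q| < 1 by rewrite ger0_norm.
exists n; have := hn n (leqnn n); rewrite /= sub0r normrN ger0_norm// exprn_ge0//.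
Qed.

(** Unique continuation: a function that is differentiable on the disc of radius
[4 r] and vanishes near 0 vanishes on the disc of radius [r].  The square of side
[2 r] centred at 0 lies between the two discs. *)
Lemma unique_continuation_disc f (r e : R) : 0 < e ->
  (forall z, nrm z < 4 * r -> derivable f z 1) ->
  (forall z, nrm z < e -> f z = 0) ->
  forall w, nrm w < r -> f w = 0.
Proof.
move=> e0 df f0 w wr; have [|ew] := ltP (nrm w) e; first exact: f0.
have r0 : 0 < r := le_lt_trans (nrm_ge0 _) wr.
have w0 : 0 < nrm w := lt_le_trans e0 ew.
have rr : - r <= r by lra.
have Bf : boundary_continuous f (- r) r (- r) r.
  have rl : - r <= - r <= r by lra.
  have rr' : - r <= r <= r by lra.
  apply: cdiff_boundary; split=> [x hx|x hx]; split; apply: derivable_cdiff; apply: df;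
    by apply: le_lt_trans (@nrm_square _ r _ _ _ _) _ => //; lra.
have [M M0 hM] : exists2 M, 0 <= M & on_boundary (- r) r (- r) r (fun z => nrm (f z) <= M).
  case: Bf => b1 b2 b3 b4.
  have [M1 m1] := segment_bounded rr b1; have [M2 m2] := segment_bounded rr b2.
  have [M3 m3] := segment_bounded rr b3; have [M4 m4] := segment_bounded rr b4.
  pose M := `|M1| + `|M2| + `|M3| + `|M4|.
  exists M; first by rewrite !addr_ge0.
  have := normr_ge0 M1; have := normr_ge0 M2; have := normr_ge0 M3; have := normr_ge0 M4.
  have := ler_norm M1; have := ler_norm M2; have := ler_norm M3; have := ler_norm M4.
  rewrite /M => *; split=> x hx; split.
  - by apply: le_trans (m1 x hx) _; lra.
  - by apply: le_trans (m2 x hx) _; lra.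
  - by apply: le_trans (m3 x hx) _; lra.
  - by apply: le_trans (m4 x hx) _; lra.
set c := rectint (fun z => (z - w)^-1) (- r) r (- r) r.
have c0 : 0 < nrm c by apply: nrm_gt0; exact: rectint_inv_neq0.
pose C := 16 * r / (r - nrm w).
have C0 : 0 <= C by rewrite divr_ge0 ?mulr_ge0//; lra.
pose K := 2 * nrm (f w) * C * M + C * M ^+ 2.
have K0 : 0 <= K.
  by apply: addr_ge0; [do !apply: mulr_ge0 => //; exact: nrm_ge0|rewrite mulr_ge0 ?exprn_ge0].
pose q := nrm w / r.
have q01 : 0 <= q < 1 by rewrite divr_ge0 ?nrm_ge0 ?(ltW r0)//= ltr_pdivrMr ?mul1r.
(* the estimate for F, multiplied by w ^+ N *)
have main N : nrm c * nrm (f w) ^+ 2 <= K * q ^+ N.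
  have ew' : e <= nrm w < r by rewrite ew.
  have [F [Fdef B2 B3 E]] : exists F : R[i] -> R[i], [/\ forall z, F z = f z / z ^+ N,
      boundary_continuous (fun z => F z / (z - w)) (- r) r (- r) r,
      boundary_continuous (fun z => F z ^+ 2 / (z - w)) (- r) r (- r) r &
      F w ^+ 2 * c = 2 * F w * rectint (fun z => F z / (z - w)) (- r) r (- r) r
        - rectint (fun z => F z ^+ 2 / (z - w)) (- r) r (- r) r].
    exists (fun z => f z / z ^+ N).
    by have [] := cauchy_estimate N e0 ew' df f0.
  pose d := r - nrm w; have d0 : 0 < d by rewrite subr_gt0.
  pose B := M / r ^+ N.
  have B0 : 0 <= B by rewrite divr_ge0 ?exprn_ge0 ?(ltW r0).
  have hF : on_boundary (- r) r (- r) r (fun z => nrm (F z) <= B /\ nrm (z - w)^-1 <= d^-1).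
    have H z : r <= nrm z /\ nrm (f z) <= M -> nrm (F z) <= B /\ nrm (z - w)^-1 <= d^-1.
      move=> [rz fM]; split.
        rewrite Fdef nrmM nrmV nrmX; apply: ler_pM; rewrite ?nrm_ge0 ?invr_ge0 ?exprn_ge0 ?nrm_ge0//.
        have z0 : 0 < nrm z := lt_le_trans r0 rz.
        by rewrite lef_pV2 ?posrE ?exprn_gt0// lerXn2r// ?nnegrE ?(ltW r0) ?(ltW z0).
      have dz : d <= nrm (z - w).
        rewrite /d lerBlDr; apply: le_trans rz _; rewrite -{1}[z](subrK w); exact: nrmD.
      by rewrite nrmV lef_pV2 ?posrE//; exact: lt_le_trans dz.
    apply: on_boundaryW H _; apply: on_boundary_and => //; exact: nrm_square_boundary.
  have i0 : 0 <= d^-1 by rewrite invr_ge0 ltW.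
  have b1 : nrm (rectint (fun z => F z / (z - w)) (- r) r (- r) r) <= C * B.
    have hB : on_boundary (- r) r (- r) r (fun z => nrm (F z / (z - w)) <= B / d).
      apply: on_boundaryW hF => z [h1 h2]; rewrite nrmM.
      by apply: ler_pM; rewrite ?nrm_ge0.
    apply: le_trans (rectint_bound rr rr B2 hB) _; rewrite /C -/d; lra.
  have b2 : nrm (rectint (fun z => F z ^+ 2 / (z - w)) (- r) r (- r) r) <= C * B ^+ 2.
    have hB : on_boundary (- r) r (- r) r (fun z => nrm (F z ^+ 2 / (z - w)) <= B ^+ 2 / d).
      apply: on_boundaryW hF => z [h1 h2]; rewrite nrmM nrmX.
      by apply: ler_pM; rewrite ?exprn_ge0 ?nrm_ge0// lerXn2r// nnegrE nrm_ge0.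
    apply: le_trans (rectint_bound rr rr B3 hB) _; rewrite /C -/d; lra.
  have {}E : nrm c * nrm (F w) ^+ 2 <= 2 * nrm (F w) * C * B + C * B ^+ 2.
    rewrite mulrC -nrmX -nrmM E; apply: le_trans (nrmB _ _) _.
    rewrite !nrmM; have -> : nrm 2 = 2 :> R.
      by rewrite -(rmorph_nat (real_complex R) 2) nrm_real ger0_norm.
    by apply: lerD => //; rewrite -[leRHS]mulrA; apply: ler_wpM2l => //; rewrite mulr_ge0 ?nrm_ge0.
  have wN : 0 < nrm w ^+ N by rewrite exprn_gt0.
  have rN : r ^+ N != 0 by rewrite expf_neq0 ?gt_eqF.
  have wN0 : nrm w ^+ N != 0 by rewrite gt_eqF.
  have FE : nrm (F w) * nrm w ^+ N = nrm (f w) by rewrite Fdef nrmM nrmV nrmX divfK.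
  have BE : B * nrm w ^+ N = M * q ^+ N by rewrite /B /q exprMn exprVn; field.
  have qN : 0 <= q ^+ N <= 1.
    by case/andP: q01 => h1 /ltW h2; rewrite exprn_ge0// exprn_ile1.
  have := ler_wpM2r (exprn_ge0 2 (ltW wN)) E.
  have -> : nrm c * nrm (F w) ^+ 2 * (nrm w ^+ N) ^+ 2 = nrm c * nrm (f w) ^+ 2.
    by rewrite -FE; ring.
  have -> : (2 * nrm (F w) * C * B + C * B ^+ 2) * (nrm w ^+ N) ^+ 2 =
     2 * (nrm (F w) * nrm w ^+ N) * C * (B * nrm w ^+ N) + C * (B * nrm w ^+ N) ^+ 2 by ring.
  rewrite FE BE => h; apply: le_trans h _; rewrite /K.
  have -> : (2 * nrm (f w) * C * M + C * M ^+ 2) * q ^+ N =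
     2 * nrm (f w) * C * (M * q ^+ N) + C * M ^+ 2 * q ^+ N by ring.
  rewrite lerD2l exprMn mulrA; apply: ler_wpM2l; first by rewrite mulr_ge0 ?exprn_ge0.
  by case/andP: qN => h1 h2; rewrite expr2 ler_piMl.
apply: nrm_eq0; apply/eqP; apply: contraT => Y0.
have Y1 : 0 < nrm (f w) by rewrite lt_def Y0 nrm_ge0.
have X0 : 0 < nrm c * nrm (f w) ^+ 2 / (K + 1) by rewrite divr_gt0 ?mulr_gt0 ?exprn_gt0// ltr_wpDl.
have [N] := expr_lt_eps q01 X0; rewrite ltr_pdivlMr ?ltr_wpDl// => hN.
have := main N; have := exprn_ge0 N (andP q01).1; nra.
Qed.
End UniqueContinuationDisc.

(** * Generic properties *)

Section VectorNorm.
Variable R : realType.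
Implicit Types (x y v : C8 R) (D : set (C8 R)) (Q : C8 R -> Prop).

(** The norm of [C8 R], as an element of [R] *)
Definition vnrm x : R := complex.Re `|x|.

Lemma vnrmE x : `|x| = (vnrm x)%:C.
Proof.
have : 0 <= `|x| by exact: normr_ge0.
by rewrite /vnrm; case: `|x| => a b; rewrite lecE/= => /andP[/eqP -> _].
Qed.

Lemma vnrm_ge0 x : 0 <= vnrm x.
Proof. by rewrite -lecR -vnrmE; exact: normr_ge0. Qed.

Lemma vnrm0 : vnrm 0 = 0. Proof. by rewrite /vnrm normr0. Qed.

Lemma vnrmD x y : vnrm (x + y) <= vnrm x + vnrm y.
Proof. by rewrite -lecR rmorphD /= -!vnrmE; exact: ler_normD. Qed.

Lemma vnrm_sub x y : vnrm (x - y) = vnrm (y - x).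
Proof. by rewrite /vnrm distrC. Qed.

Lemma vnrm_triangle z x y : vnrm (x - y) <= vnrm (x - z) + vnrm (z - y).
Proof. by apply: le_trans (vnrmD _ _); rewrite addrA subrK. Qed.

Lemma vnrmZ (t : R[i]) x : vnrm (t *: x) = nrm t * vnrm x.
Proof.
have : (vnrm (t *: x))%:C = (nrm t * vnrm x)%:C.
  by rewrite rmorphM /= -!vnrmE normrZ.
by case.
Qed.

Lemma nbhs_vnrmP x (A : set (C8 R)) :
  nbhs x A <-> exists2 e : R, 0 < e & forall y, vnrm (y - x) < e -> A y.
Proof.
split.
  move=> /nbhs_normP[e /= e0 h]; exists (complex.Re e).
    by move: e0; rewrite ltcE => /andP[].
  move=> y hy; apply: h; rewrite /ball_/= distrC vnrmE.
  by move: e0 hy; case: e => a b; rewrite !ltcE/= => /andP[/eqP -> _] ->; rewrite eqxx.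
move=> [e e0 h]; apply: (nbhs_normP x A).2; exists e%:C => /=; first by rewrite ltcR.
by move=> y; rewrite /ball_/= distrC vnrmE ltcR => /h.
Qed.

Lemma open_vnrmP (U : set (C8 R)) : open U <->
  forall x, U x -> exists2 e : R, 0 < e & forall y, vnrm (y - x) < e -> U y.
Proof. by rewrite openE; split=> H x /H/nbhs_vnrmP. Qed.

Lemma closure_vnrmP (A : set (C8 R)) x : closure A x <->
  forall e : R, 0 < e -> exists2 y, A y & vnrm (y - x) < e.
Proof.
split=> [H e e0|H B /nbhs_vnrmP[e e0 hB]].
  have [|y [Ay yx]] := H [set y | vnrm (y - x) < e]; last by exists y.
  by apply/nbhs_vnrmP; exists e.
by have [y Ay yx] := H e e0; exists y; split=> //; exact: hB.
Qed.

(** [Q] holds on a neighbourhood of [x] in [D] *)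
Definition locally_on D Q x := exists2 d : R, 0 < d &
  forall y, D y -> vnrm (y - x) < d -> Q y.

Lemma locally_on_near D Q x : locally_on D Q x ->
  exists2 d : R, 0 < d & forall y, vnrm (y - x) < d -> locally_on D Q y.
Proof.
move=> [d d0 h]; exists (d / 2) => [|y yx]; first by rewrite divr_gt0.
exists (d / 2) => [|z Dz zy]; first by rewrite divr_gt0.
by apply: h => //; have := vnrm_triangle y z x; lra.
Qed.

Lemma locally_on_and D Q Q' x : locally_on D Q x -> locally_on D Q' x ->
  locally_on D (fun y => Q y /\ Q' y) x.
Proof.
move=> [d d0 h] [e e0 k]; exists (Num.min d e); first by rewrite lt_min d0.
by move=> y Dy; rewrite lt_min => /andP[/h h1 /k h2]; split; [exact: h1|exact: h2].
Qed.

Lemma locally_onW D Q Q' x : (forall y, D y -> Q y -> Q' y) ->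
  locally_on D Q x -> locally_on D Q' x.
Proof. by move=> QQ [d d0 h]; exists d => // y Dy /h; move/(_ Dy); exact: QQ. Qed.

Lemma locally_on_ball D x y (r : R) : vnrm (y - x) < r ->
  locally_on D (fun z => vnrm (z - x) < r) y.
Proof.
move=> h; exists (r - vnrm (y - x)); first by rewrite subr_gt0.
by move=> z _ zy; have := vnrm_triangle y z x; lra.
Qed.

Lemma locally_on_self D Q x : D x -> locally_on D Q x -> Q x.
Proof. by move=> Dx [d d0 h]; apply: h; rewrite // subrr vnrm0. Qed.

(** A property is generic on [D] when it holds locally on [D] around points
arbitrarily close to each point of [D]. *)
Lemma genericallyP D Q : generically D Q <-> forall x, D x ->
  forall e : R, 0 < e -> exists y, [/\ D y, vnrm (y - x) < e & locally_on D Q y].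
Proof.
split=> [[U [oU dU hU]] x Dx e e0|H].
  have /closure_vnrmP/(_ e e0)[y [Dy Uy] yx] := dU x Dx; exists y; split=> //.
  have /open_vnrmP/(_ y Uy)[d d0 hd] := oU; exists d => // z Dz /hd; exact: hU.
exists (locally_on D Q); split.
- by apply/open_vnrmP => x; exact: locally_on_near.
- move=> x Dx; apply/closure_vnrmP => e e0; have [y [Dy yx ly]] := H x Dx e e0.
  by exists y.
- by move=> x Dx; exact: locally_on_self.
Qed.

Lemma generically_near D Q x (e : R) : generically D Q -> D x -> 0 < e ->
  exists y, [/\ D y, vnrm (y - x) < e & locally_on D Q y].
Proof. by move=> /genericallyP H Dx e0; exact: H. Qed.

Lemma generically_and D Q Q' : generically D Q -> generically D Q' ->
  generically D (fun x => Q x /\ Q' x).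
Proof.
move=> H H'; apply/genericallyP => x Dx e e0.
have [y [Dy yx ly]] := generically_near H Dx e0.
have [d d0 hd] := locally_on_near ly.
have [r r0 hr] := locally_on_ball D yx.
have [z [Dz zy lz]] := @generically_near _ _ y (Num.min d r) H' Dy ltac:(by rewrite lt_min d0).
move: zy; rewrite lt_min => /andP[/hd ? /(hr _ Dz) ?].
by exists z; split=> //; exact: locally_on_and.
Qed.

Lemma genericallyW D Q Q' : (forall x, D x -> Q x -> Q' x) ->
  generically D Q -> generically D Q'.
Proof.
move=> QQ H; apply/genericallyP => x Dx e e0.
have [y [Dy yx ly]] := generically_near H Dx e0.
by exists y; split=> //; exact: locally_onW ly.
Qed.

Lemma generically_all D Q : (forall x, D x -> Q x) -> generically D Q.
Proof.
move=> H; apply/genericallyP => x Dx e e0; exists x; split=> //.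
  by rewrite subrr vnrm0.
by exists 1 => // y Dy _; exact: H.
Qed.

Lemma generically_shift D D' Q v : (forall x, D' x <-> D (x + v)) ->
  generically D Q -> generically D' (fun x => Q (x + v)).
Proof.
move=> DD H; apply/genericallyP => x /DD Dx e e0.
have [y [Dy yx [d d0 hd]]] := generically_near H Dx e0.
exists (y - v); split; first by apply/DD; rewrite subrK.
  by rewrite -addrA -opprD [v + x]addrC.
by exists d => // z /DD Dz zy; apply: hd => //; rewrite opprB addrA in zy.
Qed.

(** A generic property of [D] is generic on each relatively open part of [D]. *)
Lemma generically_open_part D D' Q : (forall x, D' x -> D x) ->
  (forall x, D' x -> locally_on D D' x) -> generically D Q -> generically D' Q.
Proof.
move=> sD oD H; apply/genericallyP => x Dx e e0.
have [d d0 hd] := oD x Dx.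
have [y [Dy yx ly]] := @generically_near _ _ x (Num.min e d) H (sD x Dx) ltac:(by rewrite lt_min e0).
move: yx; rewrite lt_min => /andP[yx /(hd _ Dy) D'y]; exists y; split=> //.
by have [r r0 hr] := ly; exists r => // z /sD Dz; exact: hr.
Qed.

Lemma generically_nonempty D Q x : D x -> generically D Q -> exists2 y, D y & Q y.
Proof.
move=> Dx H; have [y [Dy _ ly]] := generically_near H Dx ltr01.
by exists y => //; exact: locally_on_self ly.
Qed.

End VectorNorm.

(** * Meromorphic functions on subsets of C^8 *)

Section Meromorphic.
Variable R : realType.
Implicit Types (x y v : C8 R) (D : set (C8 R)) (f g p q : C8 R -> R[i]).

Lemma differentiable_near_neq0 p x : differentiable p x -> p x != 0 ->
  exists2 e : R, 0 < e & forall y, vnrm (y - x) < e -> p y != 0.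
Proof.
move=> /differentiable_continuous cp px0; apply/nbhs_vnrmP.
have /cp : nbhs (p x) [set z | z != 0].
  apply/nbhs_nrmP; exists (nrm (p x)); first exact: nrm_gt0.
  by move=> w; apply: contraTneq => ->; rewrite sub0r nrmN ltxx.
by [].
Qed.

(** On the ball of radius [r] around [x], the function [f] is the quotient [p / q]
of differentiable functions, with [q] nonzero on a dense part of [D] there. *)
Definition local_quotient D f x (r : R) p q :=
  [/\ forall y, vnrm (y - x) < r -> differentiable p y /\ differentiable q y,
      forall y (e : R), D y -> vnrm (y - x) < r -> 0 < e ->
        exists z, [/\ D z, vnrm (z - y) < e, vnrm (z - x) < r & q z != 0]
    & forall y, D y -> vnrm (y - x) < r -> q y != 0 -> f y = p y / q y].

Lemma meromorphic_onP D f : meromorphic_on D f <-> forall x, D x ->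
  exists (r : R) p q, 0 < r /\ local_quotient D f x r p q.
Proof.
split=> H x Dx.
  have [U [p [q [[oU Ux] [hp hq] dq fpq]]]] := H x Dx.
  have /open_vnrmP/(_ x Ux)[r r0 hr] := oU; exists r, p, q; split=> //; split.
  - by move=> y /hr Uy; split; [exact: hp|exact: hq].
  - move=> y e Dy yx e0.
    have /closure_vnrmP/(_ (Num.min e (r - vnrm (y - x))))[] := dq y (conj Dy (hr _ yx)).
      by rewrite lt_min e0 subr_gt0.
    move=> z [[Dz Uz] /= qz]; rewrite lt_min => /andP[zy zr]; exists z; split=> //.
    by have := vnrm_triangle y z x; lra.
  - by move=> y Dy /hr Uy; exact: fpq.
have [r [p [q [r0 [hpq dq fpq]]]]] := H x Dx.
have bx : vnrm (x - x) < r by rewrite subrr vnrm0.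
exists [set y | vnrm (y - x) < r], p, q; split.
- split=> //; apply/open_vnrmP => y yx; exists (r - vnrm (y - x)); first by rewrite subr_gt0.
  by move=> z zy /=; have := vnrm_triangle y z x; lra.
- by split=> y /hpq[].
- move=> y [Dy yx]; apply/closure_vnrmP => e e0.
  by have [z [Dz zy zx qz]] := dq y e Dy yx e0; exists z.
- by move=> y Dy yx; exact: fpq.
Qed.

Lemma meromorphic_shift D D' f v : (forall x, D' x <-> D (x + v)) ->
  meromorphic_on D f -> meromorphic_on D' (fun x => f (x + v)).
Proof.
move=> DD /meromorphic_onP H; apply/meromorphic_onP => x /DD Dx.
have [r [p [q [r0 [hpq dq fpq]]]]] := H _ Dx.
have sh y : y + v - (x + v) = y - x by rewrite opprD addrACA subrr addr0.
have dsh p' y : differentiable p' (y + v) -> differentiable (fun y => p' (y + v)) y.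
  move=> dp.
  have ds : differentiable (fun y : C8 R => y + v) y.
    by apply: differentiableD; [exact: ex_diff|exact: differentiable_cst].
  exact: (differentiable_comp ds dp).
exists r, (fun y => p (y + v)), (fun y => q (y + v)); split=> //; split.
- move=> y; rewrite -sh => /hpq[dp dq'].
  by split; exact: dsh.
- move=> y e /DD Dy; rewrite -sh => yx e0.
  have [z [Dz zy zx qz]] := dq _ e Dy yx e0; exists (z - v); split.
  + by apply/DD; rewrite subrK.
  + by rewrite -addrA -opprD [v + y]addrC.
  + by rewrite -addrA -opprD [v + x]addrC.
  + by rewrite subrK.
- by move=> y /DD Dy; rewrite -sh => yx; exact: fpq.
Qed.

Lemma local_quotient_gen D f x (r : R) p q : local_quotient D f x r p q ->
  forall y (e : R), D y -> vnrm (y - x) < r -> 0 < e ->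
   exists z, [/\ D z, vnrm (z - y) < e, vnrm (z - x) < r & locally_on D (fun z => q z != 0) z].
Proof.
move=> [hpq dq _] y e Dy yx e0; have [z [Dz zy zx qz]] := dq y e Dy yx e0.
exists z; split=> //.
have [d d0 hd] := differentiable_near_neq0 (hpq z zx).2 qz.
by exists d => // t _ /hd.
Qed.

Lemma local_quotientS D f x (r s : R) p q : s <= r ->
  local_quotient D f x r p q -> local_quotient D f x s p q.
Proof.
move=> sr [hpq dq fpq]; split.
- by move=> y yx; apply: hpq; exact: lt_le_trans sr.
- move=> y e Dy yx e0.
  have [||z [Dz zy zx qz]] := dq y (Num.min e (s - vnrm (y - x))) Dy.
  + exact: lt_le_trans sr.
  + by rewrite lt_min e0 subr_gt0.
  move: zy; rewrite lt_min => /andP[zy zs]; exists z; split=> //.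
  by have := vnrm_triangle y z x; lra.
- by move=> y Dy yx; apply: fpq => //; exact: lt_le_trans sr.
Qed.

Lemma meromorphicM D f g : meromorphic_on D f -> meromorphic_on D g ->
  meromorphic_on D (fun x => f x * g x).
Proof.
move=> /meromorphic_onP F /meromorphic_onP G; apply/meromorphic_onP => x Dx.
have [r1 [p1 [q1 [r10 L1]]]] := F x Dx; have [r2 [p2 [q2 [r20 L2]]]] := G x Dx.
pose r := Num.min r1 r2; have r0 : 0 < r by rewrite lt_min r10.
have [rr1 rr2] : r <= r1 /\ r <= r2 by rewrite /r !ge_min !lexx orbT.
have {}L1 := local_quotientS rr1 L1; have {}L2 := local_quotientS rr2 L2.
exists r, (fun x => p1 x * p2 x), (fun x => q1 x * q2 x); split; [exact: r0|split].
- move=> y yx; have [h1 _ _] := L1; have [h2 _ _] := L2.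
  have [? ?] := h1 y yx; have [? ?] := h2 y yx.
  by split; apply: differentiableM.
- move=> y e Dy yx e0.
  have [z [Dz zy zx [d d0 hd]]] := local_quotient_gen L1 Dy yx e0.
  pose e' := Num.min d (e - vnrm (z - y)).
  have e'0 : 0 < e' by rewrite lt_min d0 subr_gt0.
  have [_ dq2 _] := L2; have [t [Dt tz tx qt]] := dq2 z e' Dz zx e'0.
  move: tz; rewrite lt_min => /andP[tz1 tz2]; exists t; split=> //.
    by have := vnrm_triangle z t y; lra.
  by rewrite mulf_neq0// hd.
- move=> y Dy yx; rewrite mulf_eq0 negb_or => /andP[h1 h2].
  have [_ _ ->//] := L1; have [_ _ ->//] := L2.
  by rewrite invfM mulrACA.
Qed.

(** The inverse is presented as [q ^+ 2 / (p * q)]: where [q] vanishes, [p / q]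
says nothing about [f]. *)
Lemma meromorphicV D f : meromorphic_on D f -> generically D (fun x => f x != 0) ->
  meromorphic_on D (fun x => (f x)^-1).
Proof.
move=> /meromorphic_onP F f0; apply/meromorphic_onP => x Dx.
have [r [p [q [r0 L]]]] := F x Dx; have [hpq dq fpq] := L.
exists r, (fun x => q x * q x), (fun x => p x * q x); split; [exact: r0|split].
- by move=> y /hpq[? ?]; split; apply: differentiableM.
- move=> y e Dy yx e0.
  have [z [Dz zy zx [d d0 hd]]] := local_quotient_gen L Dy yx e0.
  pose e' := Num.min d (Num.min (e - vnrm (z - y)) (r - vnrm (z - x))).
  have e'0 : 0 < e' by rewrite !lt_min d0 !subr_gt0 zy.
  have [t [Dt tz lt]] := generically_near f0 Dz e'0.
  move: tz; rewrite !lt_min => /and3P[tz1 tz2 tz3].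
  have tx : vnrm (t - x) < r by have := vnrm_triangle z t x; lra.
  have qt := hd t Dt tz1; exists t; split=> //.
    by have := vnrm_triangle z t y; lra.
  rewrite mulf_neq0//; have := locally_on_self Dt lt; rewrite fpq//.
  by apply: contraNneq => ->; rewrite mul0r.
- move=> y Dy yx; rewrite mulf_eq0 negb_or => /andP[h1 h2].
  by rewrite fpq// invf_div invfM mulrACA divff// mulr1.
Qed.

Lemma meromorphic_entire D f : (forall x, differentiable f x) -> meromorphic_on D f.
Proof.
move=> df; apply/meromorphic_onP => x Dx; exists 1, f, (fun=> 1); split=> //; split.
- by move=> y _; split=> //; exact: differentiable_cst.
- by move=> y e Dy yx e0; exists y; split; rewrite ?subrr ?vnrm0 ?oner_neq0.
- by move=> y _ _ _; rewrite divr1.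
Qed.

Lemma generically_neq0_not D f x : D x -> generically D (fun x => f x != 0) ->
  ~ generically D (fun x => f x = 0).
Proof.
move=> Dx h h'; have [y Dy [h1 h2]] := generically_nonempty Dx (generically_and h h').
by rewrite h2 eqxx in h1.
Qed.

(** Restriction to a relatively open part *)
Lemma meromorphic_open_part D D' f :
  (forall x, D' x -> D x) -> (forall x, D' x -> locally_on D D' x) ->
  meromorphic_on D f -> meromorphic_on D' f.
Proof.
move=> sD oD /meromorphic_onP F; apply/meromorphic_onP => x Dx.
have [r [p [q [r0 L]]]] := F x (sD x Dx); have [d d0 hd] := oD x Dx.
pose s := Num.min r d; have s0 : 0 < s by rewrite lt_min r0.
have [sr sd] : s <= r /\ s <= d by rewrite /s !ge_min !lexx orbT.
have [hpq dq fpq] := local_quotientS sr L.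
exists s, p, q; split=> //; split=> //.
- move=> y e Dy yx e0; have [z [Dz zy zx qz]] := dq y e (sD y Dy) yx e0.
  by exists z; split=> //; apply: hd => //; exact: lt_le_trans sd.
- by move=> y Dy; apply: fpq; exact: sD.
Qed.

End Meromorphic.

Section IdentityTheorem.
Variable R : realType.
Implicit Types (x y v : C8 R) (k : R[i]) (f p q : C8 R -> R[i]).

Lemma dotDr (u v w : C8 R) : dot u (v + w) = dot u v + dot u w.
Proof. by rewrite -big_split; apply: eq_bigr => i _; rewrite mxE mulrDr. Qed.

Lemma dotZr (a : R[i]) (u v : C8 R) : dot u (a *: v) = a * dot u v.
Proof. by rewrite /dot mulr_sumr; apply: eq_bigr => i _; rewrite mxE mulrCA. Qed.

Lemma dotC (u v : C8 R) : dot u v = dot v u.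
Proof. by apply: eq_bigr => i _; rewrite mulrC. Qed.

Lemma dotNr (u v : C8 R) : dot u (- v) = - dot u v.
Proof. by rewrite -scaleN1r dotZr mulN1r. Qed.

Lemma dotBr (u v w : C8 R) : dot u (v - w) = dot u v - dot u w.
Proof. by rewrite dotDr dotNr. Qed.

Lemma hyperplane_line k x y (t : R[i]) : hyperplane k x -> hyperplane k y ->
  hyperplane k (x + t *: (y - x)).
Proof. by rewrite /hyperplane/= dotDr dotZr dotBr => -> ->; rewrite subrr mulr0 addr0. Qed.

(** Unique continuation along the complex lines of the hyperplane.  The radius of
the ball where [p] vanishes depends on [r] only, not on [e]. *)
Lemma continuation_on_ball k p x y (r e : R) : 0 < e -> hyperplane k y ->
  (forall z, vnrm (z - x) < r -> differentiable p z) -> vnrm (y - x) < r / 2 ->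
  (forall z, hyperplane k z -> vnrm (z - y) < e -> p z = 0) ->
  forall z, hyperplane k z -> vnrm (z - y) < r / 16 -> p z = 0.
Proof.
move=> e0 Hy dp yx p0 z Hz zy.
pose v := z - y; pose F (t : R[i]) := p (y + t *: v).
have -> : p z = F 1 by rewrite /F scale1r /v addrC subrK.
have v0 : 0 <= vnrm v by exact: vnrm_ge0.
have r0 : 0 < r by rewrite -/v in zy; lra.
(* for |t| < 8 the point y + t v is within r / 2 of y *)
apply: (@unique_continuation_disc R F 2 (e / (vnrm v + 1))).
- by rewrite divr_gt0// ltr_wpDl.
- move=> t ht; apply/derivable1_diffP.
  have dl : differentiable (fun t : R[i] => y + t *: v) t.
    apply: differentiableD; first exact: differentiable_cst.
    by apply: differentiableZl; exact: ex_diff.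
  apply: (differentiable_comp dl).
  apply: dp; have := vnrm_triangle y (y + t *: v) x.
  rewrite [y + _]addrC addrK vnrmZ.
  have : nrm t * vnrm v <= 8 * vnrm v by apply: ler_wpM2r => //; lra.
  rewrite -/v in zy; lra.
- move=> t; rewrite ltr_pdivlMr ?ltr_wpDl// => ht; apply: p0.
    exact: hyperplane_line.
  rewrite [y + _]addrC addrK vnrmZ.
  have := nrm_ge0 t; lra.
- by rewrite [nrm 1]Normc.normc1; lra.
Qed.

(** A meromorphic function on a hyperplane vanishes generically or is generically
nonzero: the closure [T] of the points around which it vanishes is relatively
open and the hyperplane is connected. *)
Lemma meromorphic_dichotomy k f : meromorphic_on (hyperplane k) f ->
  generically (hyperplane k) (fun x => f x = 0) \/
  generically (hyperplane k) (fun x => f x != 0).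
Proof.
set H := hyperplane k => /meromorphic_onP F.
have [|nG] := pselect (generically H (fun x => f x != 0)); [by right|left].
pose Z := locally_on H (fun x => f x = 0).
pose T x := forall e : R, 0 < e -> exists y, [/\ H y, vnrm (y - x) < e & Z y].
apply/genericallyP.
(* f vanishes locally somewhere, being not generically nonzero *)
have [y0 Hy0 Zy0] : exists2 y0, H y0 & Z y0.
  apply: contrapT => nZ; apply: nG; apply/genericallyP => x Hx e e0.
  have [r [p [q [r0 L]]]] := F x Hx; have [hpq dq fpq] := L.
  have [|y [Hy yxe yx [d d0 hd]]] := @local_quotient_gen _ _ _ _ _ _ _ L x e Hx _ e0.
    by rewrite subrr vnrm0.
  have [s s0 hs] := locally_on_ball H yx.
  have [t t0 ht] := locally_on_ball H yxe.
  pose m := Num.min d (Num.min s t).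
  have m0 : 0 < m by rewrite !lt_min d0 s0.
  have [z [Hz zy pz]] : exists z, [/\ H z, vnrm (z - y) < m & p z != 0].
    apply: contrapT => np; apply: nZ; exists y => //; exists m => // z Hz zm.
    move: (zm); rewrite !lt_min => /and3P[z1 z2 z3].
    rewrite (fpq z Hz (hs z Hz z2) (hd z Hz z1)).
    have [->|pz] := eqVneq (p z) 0; first by rewrite mul0r.
    by case: np; exists z.
  move: zy; rewrite !lt_min => /and3P[z1 z2 z3].
  exists z; split=> //; first exact: ht.
  have [u u0 hu] := differentiable_near_neq0 (hpq z (hs z Hz z2)).1 pz.
  have [w w0 hw] := locally_on_ball H z1; have [v vp hv] := locally_on_ball H z2.
  exists (Num.min u (Num.min w v)); first by rewrite !lt_min u0 w0.
  move=> a Ha; rewrite !lt_min => /and3P[a1 a2 a3].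
  have qa := hd a Ha (hw a Ha a2).
  by rewrite (fpq a Ha (hs a Ha (hv a Ha a3)) qa) mulf_neq0 ?invr_neq0// hu.
(* the numerator vanishes near a point of Z close to x, hence on a ball
   around it of fixed radius, which contains x *)
have openT x : H x -> T x -> exists2 r : R, 0 < r & forall y, H y -> vnrm (y - x) < r -> T y.
  move=> Hx Tx; have [r [p [q [r0 L]]]] := F x Hx; have [hpq dq fpq] := L.
  have r32 : r / 32 <= r by lra.
  have [y [Hy yx [d d0 hd]]] := Tx (r / 32) ltac:(by rewrite divr_gt0).
  have yr : vnrm (y - x) < r by lra.
  have [s s0 hs] := locally_on_ball H yr.
  have pzero : forall z, H z -> vnrm (z - y) < r / 16 -> p z = 0.
    apply: (@continuation_on_ball k p x y r (Num.min d s)) => //.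
    - by rewrite lt_min d0.
    - by move=> z /hpq[].
    - lra.
    move=> z Hz; rewrite lt_min => /andP[zd /(hs z Hz) zr].
    have [//|pz] := eqVneq (p z) 0.
    have [u u0 hu] := differentiable_near_neq0 (hpq z zr).1 pz.
    have [w w0 hw] := locally_on_ball H zd.
    have [a [Ha az ar qa]] := dq z (Num.min u w) Hz zr ltac:(by rewrite lt_min u0).
    move: az; rewrite lt_min => /andP[/hu pa /(hw a Ha) /(hd a Ha)].
    by rewrite (fpq a Ha ar qa) => /eqP; rewrite mulf_eq0 invr_eq0 (negPf pa) (negPf qa).
  exists (r / 32); first by rewrite divr_gt0.
  move=> z Hz zx e e0; have zr : vnrm (z - x) < r / 32 by [].
  pose e' := Num.min e (r / 32 - vnrm (z - x)).
  have [||a [Ha az ar [b b0 hb]]] := @local_quotient_gen _ _ _ _ _ _ _ L z e' Hz.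
  + by lra.
  + by rewrite lt_min e0 subr_gt0.
  move: az; rewrite lt_min => /andP[ae az]; exists a; split=> //.
  pose c := r / 32 - vnrm (a - x).
  have ax := vnrm_triangle z a x.
  exists (Num.min b c); first by rewrite lt_min b0 /c; lra.
  move=> t Ht; rewrite lt_min => /andP[/(hb t Ht) qt]; rewrite /c => tc.
  have tx := vnrm_triangle a t x; have ty := vnrm_triangle x t y.
  rewrite (vnrm_sub x y) in ty.
  have tr32 : vnrm (t - x) < r / 32 by apply: le_lt_trans tx _; rewrite -ltrBrDr.
  have pt : p t = 0.
    apply: (pzero t Ht); apply: le_lt_trans ty _.
    have -> : r / 16 = r / 32 + r / 32 by field.
    exact: ltrD tr32 yx.
  have tr := lt_le_trans tr32 r32.
  by rewrite (fpq t Ht tr qt) pt mul0r.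
suff allT x : H x -> T x by move=> x /allT.
move=> Hx.
have v1 : 0 < vnrm (x - y0) + 1 by rewrite ltr_wpDl ?vnrm_ge0.
have [l lE] : exists l : R -> C8 R, forall t, l t = y0 + t%:C *: (x - y0).
  by exists (fun t => y0 + t%:C *: (x - y0)).
have Hl t : H (l t) by rewrite lE; exact: hyperplane_line.
have lsub s t : vnrm (l s - l t) = `|s - t| * vnrm (x - y0).
  rewrite !lE opprD addrACA subrr add0r -scalerBl -rmorphB vnrmZ nrm_real//.
have ln s t (e : R) : 0 < e -> `|s - t| < e / (vnrm (x - y0) + 1) -> vnrm (l s - l t) < e.
  move=> e0; rewrite (ltr_pdivlMr _ _ v1) lsub; have := normr_ge0 (s - t); lra.
(* the line from y0 to x meets T in an open and closed set of parameters *)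
pose B : set R := [set t | T (l t)].
have : B = setT.
  have cR : connected [set: R] by apply/connected_intervalP => a b _ _ c _.
  apply: cR.
  - exists 0; rewrite /B/= lE scale0r addr0 => e e0.
    by exists y0; rewrite subrr vnrm0.
  - exists B; last by rewrite setTI.
    rewrite openE => t Bt; have [r r0 hr] := openT _ (Hl t) Bt.
    apply/nbhs_normP; exists (r / (vnrm (x - y0) + 1)) => /=.
      exact: divr_gt0 r0 v1.
    by move=> s; rewrite /ball_/= distrC => st; apply: hr => //; exact: ln.
  - exists B; last by rewrite setTI.
    move=> t Bt e e0; have e20 : 0 < e / 2 by rewrite divr_gt0.
    have [|s [Bs]] := Bt [set s | `|t - s| < e / 2 / (vnrm (x - y0) + 1)].
      apply/nbhs_normP; exists (e / 2 / (vnrm (x - y0) + 1)) => /=; first exact: divr_gt0 e20 v1.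
      by [].
    rewrite /= distrC => /(ln _ _ _ e20) st; have [y [Hy ys Zy]] := Bs _ e20.
    exists y; split; [exact: Hy| |exact: Zy].
    apply: le_lt_trans (vnrm_triangle (l s) y (l t)) _.
    by rewrite [ltRHS]splitr; apply: ltrD ys st.
move/seteqP => [_ /(_ 1 I)]; rewrite /B/= lE scale1r addrC subrK.
exact.
Qed.

End IdentityTheorem.

(** * The function [br] *)

Section SigmaFunction.
Variable R : realType.
Variable br : R[i] -> R[i].
Hypothesis br_entire : entire br.
Hypothesis br_neq0 : exists z, br z != 0.
Hypothesis br_three_term : three_term br.
Implicit Types (x y v a b : C8 R) (z w c : R[i]).

(** By unique continuation, the zeros of [br] have no interior point. *)
Lemma br_dense z (e : R) : 0 < e -> exists2 w, nrm (w - z) < e & br w != 0.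
Proof.
move=> e0; apply: contrapT => nz; have [u /eqP] := br_neq0; apply.
have -> : br u = (fun w => br (w + z)) (u - z) by rewrite /= subrK.
apply: (@unique_continuation_disc R (fun w => br (w + z)) (nrm (u - z) + 1) e) => //.
- move=> w _; apply/derivable1_diffP.
  have ds : differentiable (fun y : R[i] => y + z) w.
    by apply: differentiableD; [exact: ex_diff|exact: differentiable_cst].
  apply: (differentiable_comp ds); exact/derivable1_diffP/br_entire.
- move=> w we /=; apply/eqP; apply: contraT => b0; case: nz; exists (w + z) => //.
  by rewrite addrK.
- by rewrite ltrDl.
Qed.

Lemma br_open z : br z != 0 ->
  exists2 e : R, 0 < e & forall w, nrm (w - z) < e -> br w != 0.
Proof.
move=> bz; have dz : derivable br z 1 by exact: br_entire.
have cb := differentiable_continuous ((derivable1_diffP _ _).1 dz).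
have /cb/nbhs_nrmP : nbhs (br z) [set t | t != 0].
  apply/nbhs_nrmP; exists (nrm (br z)); first exact: nrm_gt0.
  by move=> w; apply: contraTneq => ->; rewrite sub0r nrmN ltxx.
by [].
Qed.

Lemma br_neq0_pair c c' : exists z, br (z + c) != 0 /\ br (z + c') != 0.
Proof.
have [w _ bw] := br_dense c ltr01; have [e e0 he] := br_open bw.
have [t tw bt] := br_dense (w - c + c') e0.
exists (t - c'); rewrite subrK; split=> //; apply: he.
by have -> : t - c' + c - w = t - (w - c + c') by ring.
Qed.

Lemma br0 : br 0 = 0.
Proof.
have [z bz] := br_neq0; have := br_three_term z 0 0 0.
rewrite /pm !addr0 !subr0 => /eqP; rewrite -!mulrDl !mulf_eq0 (negPf bz) !orbF.
have -> : br 0 + br 0 + br 0 = br 0 *+ 3 by ring.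
by rewrite mulrn_eq0 /= orbb => /eqP.
Qed.

(** Take [gamma = beta] in the three-term relation. *)
Lemma br_odd z : br (- z) = - br z.
Proof.
have [s bs] := br_neq0.
pose al := (s - z) / 2; pose be := (s + z) / 2.
have [t [t1 t2]] := br_neq0_pair be (- be).
have := br_three_term t al be be.
have E1 : be + al = s by rewrite /be /al; field.
have E2 : be - al = z by rewrite /be /al; field.
rewrite /pm subrr br0 mulr0 mul0r add0r -[al - be]opprB E2 [al + be]addrC E1.
rewrite -mulrDl -mulrDr => /eqP; rewrite !mulf_eq0 (negPf bs) (negPf t1) (negPf t2) !orbF/=.
by rewrite addrC addr_eq0 => /eqP.
Qed.

Lemma pm_br_sym z w : pm br z w = - pm br w z.
Proof. by rewrite /pm [w + z]addrC -(opprB z w) br_odd mulrN opprK. Qed.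

(** The zero set is closed under differences: take [beta + gamma = z] and
[alpha - beta = c] in the three-term relation. *)
Lemma br_zero_sub z c : br z = 0 -> br (z + c) = 0 -> br c = 0.
Proof.
move=> bz bzc; apply/eqP; apply: contraT => bc.
have [y by0] := br_neq0.
pose be := (y - c) / 2; pose al := be + c; pose ga := z - be.
have [t [t1 t2]] := br_neq0_pair (z - be) (be - z).
have := br_three_term t al be ga.
have E1 : be + ga = z by rewrite /ga; ring.
have E2 : ga + al = z + c by rewrite /ga /al; ring.
have E3 : al - be = c by rewrite /al; ring.
have E4 : al + be = y by rewrite /al /be; field.
rewrite /pm E1 E2 E3 E4 bz bzc !mul0r !add0r => /eqP.
have -> : t - ga = t + (be - z) by rewrite /ga; ring.
by rewrite /ga !mulf_eq0 (negPf by0) (negPf bc) (negPf t1) (negPf t2).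
Qed.

Lemma differentiable_dot a x : differentiable (dot a) x.
Proof.
have -> : dot a = \sum_i (fun y : C8 R => a 0 i * y 0 i).
  by apply/funext => y; rewrite fct_sumE.
apply: differentiable_sum => i.
apply: differentiableM; first exact: differentiable_cst.
exact: differentiable_coord.
Qed.

Lemma differentiable_br_dot a x : differentiable (fun x => br (dot a x)) x.
Proof.
apply: (differentiable_comp (differentiable_dot a x)).
exact/derivable1_diffP/br_entire.
Qed.

Lemma brpm_dot a b x : brpm br a b x = br (dot (a + b) x) * br (dot (a - b) x).
Proof. by rewrite /brpm /pm ![dot (_ + _) x]dotC dotBr dotDr !(dotC x). Qed.

Lemma differentiable_brpm a b x : differentiable (brpm br a b) x.
Proof.
have -> : brpm br a b = (fun x => br (dot (a + b) x) * br (dot (a - b) x)).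
  by apply/funext => y; exact: brpm_dot.
by apply: differentiableM; exact: differentiable_br_dot.
Qed.

(** [[(a|x)]] is generically nonzero on the hyperplanes, unless [(a|x)] is
constant on them. *)
Lemma generically_br_dot (k : R[i]) a v : dot (phi R) v = 0 -> dot a v != 0 ->
  generically (hyperplane k) (fun x => br (dot a x) != 0).
Proof.
move=> pv av; apply/genericallyP => x Hx e e0.
pose d := e / (vnrm v + 1) * nrm (dot a v).
have v1 : 0 < vnrm v + 1 by rewrite ltr_wpDl ?vnrm_ge0.
have d0 : 0 < d by rewrite mulr_gt0 ?divr_gt0 ?nrm_gt0.
have [w wa bw] := br_dense (dot a x) d0.
pose t := (w - dot a x) / dot a v.
have ay : dot a (x + t *: v) = w.
  by rewrite dotDr dotZr /t divfK// addrC subrK.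
exists (x + t *: v); split.
- by rewrite /hyperplane/= dotDr dotZr pv mulr0 addr0.
- rewrite [x + _]addrC addrK vnrmZ nrmM nrmV.
  move: wa; rewrite /d -ltr_pdivrMr ?nrm_gt0// ltr_pdivlMr//.
  by apply: le_lt_trans; apply: ler_wpM2l; rewrite ?mulr_ge0 ?invr_ge0 ?nrm_ge0// lerDl.
- have bw' : br (dot a (x + t *: v)) != 0 by rewrite ay.
  have [r r0 hr] := differentiable_near_neq0 (differentiable_br_dot a (x + t *: v)) bw'.
  by exists r => // y _ /hr.
Qed.

Lemma generically_brpm (k : R[i]) a b v u : dot (phi R) v = 0 -> dot (a + b) v != 0 ->
  dot (phi R) u = 0 -> dot (a - b) u != 0 ->
  generically (hyperplane k) (fun x => brpm br a b x != 0).
Proof.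
move=> pv av pw aw.
have := generically_and (generically_br_dot k pv av) (generically_br_dot k pw aw).
by apply: genericallyW => x _ [h1 h2]; rewrite brpm_dot mulf_neq0.
Qed.

End SigmaFunction.

(** * The Desnanot-Jacobi identity *)

Section Jacobi.
Variables (F : fieldType) (A : nat -> nat -> F).

(** Determinant of a bordered matrix, by the Schur complement *)
Lemma det_schur m k (M : 'M[F]_m) (W : 'M[F]_(m, k)) (V : 'M[F]_(k, m)) (D : 'M[F]_k) :
  \det M != 0 ->
  \det (block_mx M W V D) = \det M * \det (D - V *m invmx M *m W).
Proof.
move=> M0; have Mu : M \in unitmx by rewrite unitmxE unitfE.
have -> : block_mx M W V D = block_mx 1%:M 0 (V *m invmx M) 1%:M
             *m block_mx M W 0 (D - V *m invmx M *m W).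
  rewrite mulmx_block !mul1mx !mul0mx !addr0 mulmxKV//.
  by rewrite addrC subrK.
by rewrite det_mulmx det_lblock det_ublock !det1 !mul1r.
Qed.

Lemma det_cast m n (G : nat -> nat -> F) : m = n ->
  \det (\matrix_(i < m, j < m) G i j) = \det (\matrix_(i < n, j < n) G i j).
Proof. by move=> ->. Qed.

(* the cyclic shift i |-> i + 1 of the indices *)
Let rot n : 'S_n.+1 := perm (@ordS_inj n.+1).

Lemma det_rotate_rows n (G : nat -> nat -> F) :
  \det (\matrix_(i < n.+1, j < n.+1) G (i.+1 %% n.+1)%N j) =
  (-1) ^+ rot n * \det (\matrix_(i < n.+1, j < n.+1) G i j).
Proof.
rewrite -det_perm -det_mulmx -row_permE; congr (\det _).
by apply/matrixP => i j; rewrite !mxE permE.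
Qed.

Lemma det_rotate_cols n (G : nat -> nat -> F) :
  \det (\matrix_(i < n.+1, j < n.+1) G i (j.+1 %% n.+1)%N) =
  (-1) ^+ rot n * \det (\matrix_(i < n.+1, j < n.+1) G i j).
Proof.
rewrite -det_tr -[\det (\matrix_(i, j) G i j)]det_tr.
have tr (H : nat -> nat -> F) : (\matrix_(i < n.+1, j < n.+1) H i j)^T = \matrix_(i, j) H j i.
  by apply/matrixP => i j; rewrite !mxE.
by rewrite (tr G) (tr (fun i j => G i (j.+1 %% n.+1)%N)) (det_rotate_rows n (fun i j => G j i)).
Qed.

Variable m : nat.
Let M : 'M[F]_m := \matrix_(i < m, j < m) A i.+1 j.+1.
(* the Schur complement of the interior M at row p and column q *)
Let S p q : F := A p q -
  ((\row_(j < m) A p j.+1) *m invmx M *m (\col_(i < m) A i.+1 q)) 0 0.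

(** Rows [r] and columns [c] list the interior indices [1, ..., m] first. *)
Lemma det_bordered k (r c : nat -> nat) : \det M != 0 ->
  (forall i, (i < m)%N -> r i = i.+1) -> (forall j, (j < m)%N -> c j = j.+1) ->
  \det (\matrix_(i < m + k, j < m + k) A (r i) (c j)) =
  \det M * \det (\matrix_(i < k, j < k) S (r (m + i)%N) (c (m + j)%N)).
Proof.
move=> M0 hr hc.
pose W := \matrix_(i < m, j < k) A i.+1 (c (m + j)%N).
pose V := \matrix_(i < k, j < m) A (r (m + i)%N) j.+1.
pose D := \matrix_(i < k, j < k) A (r (m + i)%N) (c (m + j)%N).
have -> : \matrix_(i < m + k, j < m + k) A (r i) (c j) = block_mx M W V D.
  apply/matrixP => i j; rewrite !mxE.
  case: splitP => i' ei; rewrite !mxE; case: splitP => j' ej; rewrite !mxE ei ej.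
  - by rewrite hr ?hc.
  - by rewrite hr.
  - by rewrite hc.
  - by [].
rewrite det_schur//; congr (_ * \det _); apply/matrixP => i j.
rewrite !mxE /S; congr (_ - _); rewrite [RHS]mxE; apply: eq_bigr => l _.
by rewrite !mxE; congr (_ * _); apply: eq_bigr => l' _; rewrite !mxE.
Qed.

Lemma det2 (G : nat -> nat -> F) : \det (\matrix_(i < 2, j < 2) G i j) =
  G 0%N 0%N * G 1%N 1%N - G 0%N 1%N * G 1%N 0%N.
Proof.
rewrite (expand_det_row _ 0) !big_ord_recl big_ord0 /cofactor !det_mx11 !mxE /=.
by rewrite /bump /=; ring.
Qed.

(** The Desnanot-Jacobi identity, when the interior minor does not vanish.  A
cyclic shift brings a leading border row or column to the end; then each minor
is, up to a sign which cancels, [\det M] times a minor of the two by two Schur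
complement. *)
Lemma desnanot_jacobi : \det (\matrix_(i < m, j < m) A i.+1 j.+1) != 0 ->
  \det (\matrix_(i < m.+2, j < m.+2) A i j) * \det (\matrix_(i < m, j < m) A i.+1 j.+1) =
  \det (\matrix_(i < m.+1, j < m.+1) A i j) * \det (\matrix_(i < m.+1, j < m.+1) A i.+1 j.+1)
  - \det (\matrix_(i < m.+1, j < m.+1) A i j.+1) * \det (\matrix_(i < m.+1, j < m.+1) A i.+1 j).
Proof.
rewrite -/M => M0.
have sgn n : (-1 : F) ^+ rot n * (-1) ^+ rot n = 1 by rewrite -signr_addb addbb.
have sgnM n (x : F) : x = (-1) ^+ rot n * ((-1) ^+ rot n * x) by rewrite mulrA sgn mul1r.
have R1 i : (i < m)%N -> (i.+1 %% m.+1)%N = i.+1 by move=> h; rewrite modn_small// ltnS.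
have R2 i : (i < m)%N -> (i.+1 %% m.+2)%N = i.+1.
  by move=> h; rewrite modn_small// ltnS ltnW// ltnS.
have e0 : \det (\matrix_(i < m.+2, j < m.+2) A i j) =
    \det M * (S m.+1 m.+1 * S 0 0 - S m.+1 0 * S 0 m.+1).
  rewrite [LHS](sgnM m.+1) -(det_rotate_cols _ (fun i j => A i j)).
  rewrite -(det_rotate_rows _ (fun i j => A i (j.+1 %% m.+2)%N)).
  rewrite (det_cast (fun i j => A (i.+1 %% m.+2)%N (j.+1 %% m.+2)%N) (esym (addn2 m))).
  rewrite (det_bordered 2 (r := fun i => (i.+1 %% m.+2)%N) (c := fun i => (i.+1 %% m.+2)%N))//.
  rewrite (det2 (fun i j => S ((m + i).+1 %% m.+2)%N ((m + j).+1 %% m.+2)%N)).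
  by rewrite addn0 addn1 modnn modn_small.
have e1 : \det (\matrix_(i < m.+1, j < m.+1) A i j) = \det M * S 0 0.
  rewrite [LHS](sgnM m) -(det_rotate_cols _ (fun i j => A i j)).
  rewrite -(det_rotate_rows _ (fun i j => A i (j.+1 %% m.+1)%N)).
  rewrite (det_cast (fun i j => A (i.+1 %% m.+1)%N (j.+1 %% m.+1)%N) (esym (addn1 m))).
  rewrite (det_bordered 1 (r := fun i => (i.+1 %% m.+1)%N) (c := fun i => (i.+1 %% m.+1)%N))//.
  by rewrite det_mx11 !mxE addn0 modnn.
have e2 : \det (\matrix_(i < m.+1, j < m.+1) A i.+1 j.+1) = \det M * S m.+1 m.+1.
  rewrite (det_cast (fun i j => A i.+1 j.+1) (esym (addn1 m))).
  by rewrite (det_bordered 1 (r := succn) (c := succn))// det_mx11 !mxE addn0.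
have e3 : \det (\matrix_(i < m.+1, j < m.+1) A i j.+1) = (-1) ^+ rot m * (\det M * S 0 m.+1).
  rewrite [LHS](sgnM m); congr (_ * _).
  rewrite -(det_rotate_rows _ (fun i j => A i j.+1)).
  rewrite (det_cast (fun i j => A (i.+1 %% m.+1)%N j.+1) (esym (addn1 m))).
  rewrite (det_bordered 1 (r := fun i => (i.+1 %% m.+1)%N) (c := succn))//.
  by rewrite det_mx11 !mxE addn0 modnn.
have e4 : \det (\matrix_(i < m.+1, j < m.+1) A i.+1 j) = (-1) ^+ rot m * (\det M * S m.+1 0).
  rewrite [LHS](sgnM m); congr (_ * _).
  rewrite -(det_rotate_cols _ (fun i j => A i.+1 j)).
  rewrite (det_cast (fun i j => A i.+1 (j.+1 %% m.+1)%N) (esym (addn1 m))).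
  rewrite (det_bordered 1 (c := fun i => (i.+1 %% m.+1)%N) (r := succn))//.
  by rewrite det_mx11 !mxE addn0 modnn.
rewrite e0 e1 e2 e3 e4 [(-1) ^+ _ * _ * _]mulrACA sgn; ring.
Qed.

End Jacobi.

(** * Casorati determinants, hyperplanes and frames *)

Section Casorati.
Variable R : realType.
Implicit Types (x a v : C8 R) (delta k : R[i]).

(** The Desnanot-Jacobi identity for Casorati determinants: deleting the extreme
rows and columns shifts the argument by [delta a1] or [delta a2], and deleting
both shifts it by [- 2 delta a0]. *)
Lemma casorati_jacobi delta a0 a1 a2 (psi : C8 R -> R[i]) n x :
  casorati delta a0 a1 a2 psi n (x - delta *: a0) != 0 ->
  casorati delta a0 a1 a2 psi n.+2 (x + delta *: a0)
    * casorati delta a0 a1 a2 psi n (x - delta *: a0) =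
  pm (casorati delta a0 a1 a2 psi n.+1) x (delta *: a1)
  - pm (casorati delta a0 a1 a2 psi n.+1) x (delta *: a2).
Proof.
pose A i j := psi_entry delta a0 a1 a2 psi n.+2 i.+1 j.+1 (x + delta *: a0).
have K0 : casorati delta a0 a1 a2 psi n (x - delta *: a0) =
    \det (\matrix_(i < n, j < n) A i.+1 j.+1).
  congr (\det _); apply/matrixP => i j; rewrite !mxE /A /psi_entry; congr psi.
  by apply/rowP => l; rewrite !mxE -!natr1; ring.
have K1 : casorati delta a0 a1 a2 psi n.+1 (x + delta *: a1) =
    \det (\matrix_(i < n.+1, j < n.+1) A i j).
  congr (\det _); apply/matrixP => i j; rewrite !mxE /A /psi_entry; congr psi.
  by apply/rowP => l; rewrite !mxE -!natr1; ring.
have K2 : casorati delta a0 a1 a2 psi n.+1 (x - delta *: a1) =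
    \det (\matrix_(i < n.+1, j < n.+1) A i.+1 j.+1).
  congr (\det _); apply/matrixP => i j; rewrite !mxE /A /psi_entry; congr psi.
  by apply/rowP => l; rewrite !mxE -!natr1; ring.
have K3 : casorati delta a0 a1 a2 psi n.+1 (x + delta *: a2) =
    \det (\matrix_(i < n.+1, j < n.+1) A i j.+1).
  congr (\det _); apply/matrixP => i j; rewrite !mxE /A /psi_entry; congr psi.
  by apply/rowP => l; rewrite !mxE -!natr1; ring.
have K4 : casorati delta a0 a1 a2 psi n.+1 (x - delta *: a2) =
    \det (\matrix_(i < n.+1, j < n.+1) A i.+1 j).
  congr (\det _); apply/matrixP => i j; rewrite !mxE /A /psi_entry; congr psi.
  by apply/rowP => l; rewrite !mxE -!natr1; ring.
by rewrite K0 => /desnanot_jacobi E; rewrite /pm K1 K2 K3 K4 -E.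
Qed.

Lemma casorati0 delta a0 a1 a2 (psi : C8 R -> R[i]) x :
  casorati delta a0 a1 a2 psi 0 x = 1.
Proof. by rewrite /casorati det_mx00. Qed.

Lemma casorati1 delta a0 a1 a2 (psi : C8 R -> R[i]) x :
  casorati delta a0 a1 a2 psi 1 x = psi x.
Proof.
rewrite /casorati det_mx11 mxE /psi_entry /=; congr psi.
by apply/rowP => l; rewrite !mxE; ring.
Qed.

Lemma generically_translate k k' v (Q : C8 R -> Prop) : k + dot (phi R) v = k' ->
  generically (hyperplane k') Q -> generically (hyperplane k) (fun x => Q (x + v)).
Proof.
move=> <-; apply: generically_shift => x; rewrite /hyperplane/= dotDr.
by split=> [->//|/addIr].
Qed.

Lemma meromorphic_translate k k' v (f : C8 R -> R[i]) : k + dot (phi R) v = k' ->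
  meromorphic_on (hyperplane k') f -> meromorphic_on (hyperplane k) (fun x => f (x + v)).
Proof.
move=> <-; apply: meromorphic_shift => x; rewrite /hyperplane/= dotDr.
by split=> [->//|/addIr].
Qed.

Lemma dot_phi_phi : dot (phi R) (phi R) = 2.
Proof.
rewrite /dot (eq_bigr (fun=> 4^-1)) => [|i _]; last by rewrite mxE; field.
by rewrite sumr_const card_ord -mulr_natl; field.
Qed.

Lemma hyperplane_nonempty k : exists x, hyperplane k x.
Proof.
exists ((k / 2) *: phi R); rewrite /hyperplane/= dotZr dot_phi_phi divfK//.
Qed.

Lemma is_intN (z : R[i]) : is_int z -> is_int (- z).
Proof. by move=> [m ->]; exists (- m); rewrite rmorphN. Qed.

Lemma is_intB (z w : R[i]) : is_int z -> is_int w -> is_int (z - w).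
Proof. by move=> [m ->] [l ->]; exists (m - l); rewrite rmorphB. Qed.

Lemma E8_latticeN (p : C8 R) : E8_lattice p -> E8_lattice (- p).
Proof.
move=> [Zp ip]; split; last by rewrite dotNr; exact: is_intN.
case: Zp => Zp; [left|right] => i.
  by rewrite mxE; apply: is_intN; exact: Zp.
have [m hm] := Zp i; exists (- m - 1); rewrite intrB mulrNz -hm !mxE.
by field.
Qed.

Lemma E8_lattice_phi_sub (p : C8 R) : E8_lattice p -> E8_lattice (phi R - p).
Proof.
move=> [Zp ip]; split; last first.
  by rewrite dotBr dot_phi_phi; apply: is_intB => //; exists 2.
case: Zp => Zp; [right|left] => i.
  have := is_intN (Zp i).
  by rewrite !mxE addrAC subrr add0r.
by have := is_intN (Zp i); rewrite !mxE opprB.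
Qed.

(** A frame with [(phi|a0) = 1] and [(phi|a1) = (phi|a2) = 0] remains a frame when
[a0] is replaced by [phi - a0]. *)
Lemma C3_frame_reflect (a0 a1 a2 : C8 R) : C3_frame a0 a1 a2 ->
  dot (phi R) a0 = 1 -> dot (phi R) a1 = 0 -> dot (phi R) a2 = 0 ->
  C3_frame (phi R - a0) a1 a2.
Proof.
move=> [/= ho hs hd] p0 p1 p2.
have o (i j : 'I_3) : dot (tnth [tuple a0; a1; a2] i) (tnth [tuple a0; a1; a2] j) = (i == j)%:R by exact: ho.
have o00 := o 0 0; have o01 := o 0 1; have o02 := o 0 2.
have o11 := o 1 1; have o12 := o 1 2; have o22 := o 2 2.
have s01 := hs 0 1 isT; have s02 := hs 0 2 isT; have s12 := hs 1 2 isT.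
have d0 := hd 0; have d1 := hd 1; have d2 := hd 2.
rewrite !(tnth_nth 0) /= in o00 o01 o02 o11 o12 o22 s01 s02 s12 d0 d1 d2.
have q0 : dot (phi R - a0) a1 = 0 by rewrite dotC dotBr dotC p1 dotC o01 subrr.
have q1 : dot (phi R - a0) a2 = 0 by rewrite dotC dotBr dotC p2 dotC o02 subrr.
have q2 : dot (phi R - a0) (phi R - a0) = 1.
  by rewrite dotBr ![dot (phi R - a0) _]dotC !dotBr dot_phi_phi p0 [dot a0 _]dotC p0 o00; ring.
split=> /=.
- move=> i j; rewrite !(tnth_nth 0).
  by case: i => [[|[|[|i]]]] //= hi; case: j => [[|[|[|j]]]] //= hj;
    rewrite ?q0 ?q1 ?q2 ?o11 ?o12 ?o22 // dotC ?q0 ?q1 ?o12.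
- move=> i j; rewrite !(tnth_nth 0).
  have t1 := E8_lattice_phi_sub s01.1; have t2 := E8_lattice_phi_sub s01.2.
  have t3 := E8_lattice_phi_sub s02.1; have t4 := E8_lattice_phi_sub s02.2.
  rewrite opprD addrA in t1; rewrite opprD opprK addrA in t2.
  rewrite opprD addrA in t3; rewrite opprD opprK addrA in t4.
  by case: i => [[|[|[|i]]]] //= hi; case: j => [[|[|[|j]]]].
- move=> i; rewrite !(tnth_nth 0).
  case: i => [[|[|[|i]]]] //= hi.
  have -> : 2 *: (phi R - a0) = - ( 2 *: a0 - phi R) + phi R.
    by apply/rowP => l; rewrite !mxE; ring.
  have := E8_lattice_phi_sub (E8_latticeN (E8_lattice_phi_sub d0)).
  by rewrite !opprB addrC.
Qed.

End Casorati.

(** * Gauge factors and the hypergeometric tau-function *)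

Section ScalarIdentities.
Variable F : fieldType.

(** The step of [gauge_ratio].  With [T, s, r] the products of [a0, a1, a2] with
the point [y] of the hyperplane, the letters stand for values of the gauge
factors at translates of [y], and for [[T +- s]], [[T - 2 delta +- s]] (B),
[[T +- r]], [[T - 2 delta +- r]] (C), [[T - delta +- r]] (D) and
[[s + delta +- r]], [[s - delta +- r]] (F). *)
Lemma gauge_ratio_scalar (X Xp Xm pp pm mp mm qv qv' qw qw' B1 B2 B3 B4 C1 C2 C3 C4
    D1 D2 F1 F2 F3 F4 : F) :
  X != 0 -> Xp != 0 -> Xm != 0 -> [/\ pp != 0, pm != 0, mp != 0 & mm != 0] ->
  [/\ qv != 0, qv' != 0, qw != 0 & qw' != 0] ->
  B3 != 0 /\ B4 != 0 -> [/\ C1 != 0, C2 != 0, C3 != 0 & C4 != 0] ->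
  D1 != 0 /\ D2 != 0 -> [/\ F1 != 0, F2 != 0, F3 != 0 & F4 != 0] ->
  Xp * X / (pp * pm) = B1 * B4 / (D1 * D2) ->
  X * Xm / (mp * mm) = B3 * B2 / (D1 * D2) ->
  qv * qv' / (qw * qw') = B3 * B4 / (C3 * C4) ->
  (Xp * X / qv * (D1 * D2 / (F1 * F2))) * (X * Xm / qv' * (D1 * D2 / (F3 * F4)))
  / ((pp * mp / qw * (C1 * C4 / (F1 * F4))) * (pm * mm / qw' * (C3 * C2 / (F3 * F2))))
  = B1 * B2 / (C1 * C2).
Proof.
move=> x0 xp0 xm0 [h1 h2 h3 h4] [h5 h6 h7 h8] [b3 b4] [c1 c2 c3 c4] [d1 d2] [f1 f2 f3 f4] e1 e2 e3.
transitivity ((Xp * X / (pp * pm)) * (X * Xm / (mp * mm)) / (qv * qv' / (qw * qw'))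
  * ((D1 * D2) ^+ 2 / (C1 * C2 * C3 * C4))).
  by field; rewrite ?x0 ?xp0 ?xm0 ?h1 ?h2 ?h3 ?h4 ?h5 ?h6 ?h7 ?h8 ?c1 ?c2 ?c3 ?c4 ?d1 ?d2 ?f1 ?f2 ?f3 ?f4.
rewrite e1 e2 e3; field.
by rewrite ?b3 ?b4 ?c1 ?c2 ?c3 ?c4 ?d1 ?d2.
Qed.

(** The step of [tau_casorati]: the first equation is the bilinear relation, where
[tm] is the value of [tau] on the lower hyperplane, and the last one is the
Desnanot-Jacobi identity. *)
Lemma casorati_step_scalar (b12 b02 b01 tp tm gm Km gv gv' gw gw' Kv Kv' Kw Kw' K2 : F) :
  b12 != 0 -> b02 != 0 -> tm != 0 -> gm != 0 -> gw != 0 -> gw' != 0 ->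
  b12 * (tp * tm) + - b02 * (gv * Kv * (gv' * Kv')) + b01 * (gw * Kw * (gw' * Kw')) = 0 ->
  tm = gm * Km -> gv * gv' / (gw * gw') = b01 / b02 ->
  K2 * Km = Kv * Kv' - Kw * Kw' ->
  tp = gv * gv' / gm * (b02 / b12) * K2.
Proof.
move=> h1 h2 h3 h4 h5 h6 E tmE G J; rewrite tmE mulf_eq0 negb_or in h3; case/andP: h3 => _ Km0.
have {}G : b01 * (gw * gw') = gv * gv' * b02.
  have gw0 : gw * gw' != 0 by rewrite mulf_neq0.
  have := congr1 (fun z => z * (gw * gw') * b02) G; rewrite divfK// => ->.
  by field.
have E2 : b12 * (tp * tm) = b02 * (gv * gv') * (K2 * Km).
  rewrite J; have := congr1 (fun z => z + b02 * (gv * Kv * (gv' * Kv')) - b01 * (gw * gw') * (Kw * Kw')) E.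
  rewrite [in X in _ = X]G add0r => E1.
  transitivity (b02 * (gv * Kv * (gv' * Kv')) - gv * gv' * b02 * (Kw * Kw')); last by ring.
  by rewrite -E1; ring.
have n0 : b12 * (gm * Km) != 0 by rewrite !mulf_neq0.
apply: (mulfI n0).
transitivity (b12 * (tp * tm)); first by rewrite tmE; ring.
by rewrite E2; field; rewrite h1 h4.
Qed.

End ScalarIdentities.

Section Hypergeometric.
Variable R : realType.
Variable br : R[i] -> R[i].
Hypothesis br_entire : entire br.
Hypothesis br_neq0 : exists z, br z != 0.
Hypothesis br_three_term : three_term br.
Variable delta : R[i].
Hypothesis delta_neq0 : delta != 0.
Variable omega : R[i].
Variables a0 a1 a2 : C8 R.
Hypothesis a_frame : C3_frame a0 a1 a2.
Hypothesis phi_a0 : dot (phi R) a0 = 1.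
Hypothesis phi_a1 : dot (phi R) a1 = 0.
Hypothesis phi_a2 : dot (phi R) a2 = 0.

(* H n is the n-th hyperplane; u and - u lead to the next and to the previous
   one, v and w are parallel to them *)
Let k (n : nat) : R[i] := omega + n%:R * delta.
Let H n : set (C8 R) := hyperplane (k n).
Let u := delta *: a0.
Let v := delta *: a1.
Let w := delta *: a2.

Lemma frame_orthonormal b0 b1 b2 : C3_frame b0 b1 b2 ->
  [/\ dot b0 b0 = 1, dot b1 b1 = 1 & dot b2 b2 = 1 :> R[i]] /\
  [/\ dot b0 b1 = 0, dot b0 b2 = 0 & dot b1 b2 = 0 :> R[i]].
Proof.
move=> [ho _ _].
have o00 := ho 0 0; have o01 := ho 0 1; have o02 := ho 0 2.
have o11 := ho 1 1; have o12 := ho 1 2; have o22 := ho 2 2.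
by rewrite !(tnth_nth 0) /= in o00 o01 o02 o11 o12 o22.
Qed.

Let o00 : dot a0 a0 = 1. Proof. by have [[]] := frame_orthonormal a_frame. Qed.
Let o11 : dot a1 a1 = 1. Proof. by have [[]] := frame_orthonormal a_frame. Qed.
Let o22 : dot a2 a2 = 1. Proof. by have [[]] := frame_orthonormal a_frame. Qed.
Let o01 : dot a0 a1 = 0. Proof. by have [_ []] := frame_orthonormal a_frame. Qed.
Let o02 : dot a0 a2 = 0. Proof. by have [_ []] := frame_orthonormal a_frame. Qed.
Let o12 : dot a1 a2 = 0. Proof. by have [_ []] := frame_orthonormal a_frame. Qed.
Let o10 : dot a1 a0 = 0. Proof. by rewrite dotC. Qed.
Let o20 : dot a2 a0 = 0. Proof. by rewrite dotC. Qed.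
Let o21 : dot a2 a1 = 0. Proof. by rewrite dotC. Qed.
Let pu : dot (phi R) u = delta. Proof. by rewrite /u dotZr phi_a0 mulr1. Qed.
Let pv : dot (phi R) v = 0. Proof. by rewrite /v dotZr phi_a1 mulr0. Qed.
Let pw : dot (phi R) w = 0. Proof. by rewrite /w dotZr phi_a2 mulr0. Qed.

Let kS n : k n.+1 = k n + delta.
Proof. by rewrite /k -natr1 mulrDl mul1r addrA. Qed.

Lemma brpm01_neq0 c : generically (hyperplane c) (fun x => brpm br a0 a1 x != 0).
Proof.
by apply: (@generically_brpm _ _ br_entire br_neq0 c a0 a1 a1 a1) => //;
  rewrite dotC ?dotBr ?dotDr o10 o11 ?add0r ?sub0r ?oppr_eq0 oner_eq0.
Qed.

Lemma brpm02_neq0 c : generically (hyperplane c) (fun x => brpm br a0 a2 x != 0).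
Proof.
by apply: (@generically_brpm _ _ br_entire br_neq0 c a0 a2 a2 a2) => //;
  rewrite dotC ?dotBr ?dotDr o20 o22 ?add0r ?sub0r ?oppr_eq0 oner_eq0.
Qed.

Lemma brpm12_neq0 c : generically (hyperplane c) (fun x => brpm br a1 a2 x != 0).
Proof.
by apply: (@generically_brpm _ _ br_entire br_neq0 c a1 a2 a1 a1) => //;
  rewrite dotC ?dotBr ?dotDr o12 o11 ?addr0 ?subr0 oner_eq0.
Qed.

(** A function with these ratios is generically nonzero: the right hand side is,
and the inverse of zero is zero. *)
Lemma ratio_neq0 c (g : C8 R -> R[i]) :
  generically (hyperplane c) (fun x => pm g x v / pm g x w = brpm br a0 a1 x / brpm br a0 a2 x) ->
  generically (hyperplane c) (fun x => g x != 0).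
Proof.
move=> h.
have hc : c + dot (phi R) (- v) = c by rewrite dotNr pv subr0.
have := generically_translate hc (generically_and h (generically_and (brpm01_neq0 c) (brpm02_neq0 c))).
apply: genericallyW => x Hx [E [n1 n2]].
have : pm g (x - v) v / pm g (x - v) w != 0 by rewrite E mulf_neq0 ?invr_eq0.
by rewrite /pm subrK !mulf_eq0 !negb_or => /andP[/andP[]].
Qed.

(** The gauge factors, from [t0] and [t1] by their recursion solved for the factor
of highest index *)
Fixpoint gauge (t0 t1 : C8 R -> R[i]) (n : nat) : C8 R -> R[i] :=
  match n with
  | 0 => t0
  | m.+1 => match m with
    | 0 => t1
    | l.+1 => fun y => pm (gauge t0 t1 m) (y - u) v / gauge t0 t1 l (y - u - u)
        * (brpm br a0 a2 (y - u) / brpm br a1 a2 (y - u))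
    end
  end.

Variables t0 t1 : C8 R -> R[i].
Hypothesis t0_mero : meromorphic_on (H 0) t0.
Hypothesis t1_mero : meromorphic_on (H 1) t1.
(* the relation required of the first two gauge factors *)
Let ratio g x := pm g x v / pm g x w = brpm br a0 a1 x / brpm br a0 a2 x.
Hypothesis t0_ratio : generically (H 0) (ratio t0).
Hypothesis t1_ratio : generically (H 1) (ratio t1).
Let g n := gauge t0 t1 n.

Let gSS n y : g n.+2 y = g n.+1 (y - u + v) * g n.+1 (y - u - v) / g n (y - u - u)
        * (brpm br a0 a2 (y - u) / brpm br a1 a2 (y - u)).
Proof. by []. Qed.

Ltac vec := by apply/rowP => ?; rewrite !mxE; ring.

(** Induction on pairs of consecutive indices *)
Lemma gauge_mero n : (meromorphic_on (H n) (g n) /\ generically (H n) (fun x => g n x != 0)) /\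
  (meromorphic_on (H n.+1) (g n.+1) /\ generically (H n.+1) (fun x => g n.+1 x != 0)).
Proof.
elim: n => [|n [[IH1 IH2] [IH3 IH4]]].
  by split; split=> //; apply: ratio_neq0.
split=> //.
have e1 : k n.+2 + dot (phi R) (v - u) = k n.+1 by rewrite dotBr pv pu !kS; ring.
have e2 : k n.+2 + dot (phi R) (- v - u) = k n.+1 by rewrite dotBr dotNr pv pu !kS; ring.
have e3 : k n.+2 + dot (phi R) (- u - u) = k n by rewrite dotBr dotNr pu !kS; ring.
have e4 : k n.+2 + dot (phi R) (- u) = k n.+1 by rewrite dotNr pu !kS; ring.
have gE : g n.+2 = (fun y => g n.+1 (y + (v - u)) * g n.+1 (y + (- v - u))
    * (g n (y + (- u - u)))^-1 * (brpm br a0 a2 (y + - u) * (brpm br a1 a2 (y + - u))^-1)).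
  apply/funext => y; rewrite gSS.
  have -> : y - u + v = y + (v - u) by vec.
  have -> : y - u - v = y + (- v - u) by vec.
  by have -> : y - u - u = y + (- u - u) by vec.
rewrite gE; split.
  apply: meromorphicM; first apply: meromorphicM; first apply: meromorphicM.
  - exact: (meromorphic_translate e1 IH3).
  - exact: (meromorphic_translate e2 IH3).
  - apply: meromorphicV; first exact: (meromorphic_translate e3 IH1).
    exact: (generically_translate e3 IH2).
  apply: meromorphicM.
    apply: (meromorphic_translate e4); apply: meromorphic_entire => x.
    exact: differentiable_brpm.
  apply: meromorphicV.
    apply: (meromorphic_translate (f := brpm br a1 a2) e4); apply: meromorphic_entire => x.
    exact: differentiable_brpm.
  exact: (generically_translate (Q := fun x => brpm br a1 a2 x != 0) e4 (brpm12_neq0 _)).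
have h1 := generically_translate e1 IH4.
have h2 := generically_translate e2 IH4.
have h3 := generically_translate e3 IH2.
have h4 := generically_translate e4 (generically_and (brpm02_neq0 _) (brpm12_neq0 _)).
have := generically_and h1 (generically_and h2 (generically_and h3 h4)).
apply: genericallyW => x _ [p1 [p2 [p3 [p4 p5]]]].
by repeat (assumption || apply: invr_neq0 || apply: mulf_neq0).
Qed.

Lemma gauge_neq0 n : generically (H n) (fun x => g n x != 0).
Proof. by have [[]] := gauge_mero n. Qed.

Lemma gauge_relation n : generically (H n.+1) (fun x =>
  g n (x - u) * g n.+2 (x + u) / pm (g n.+1) x v = brpm br a0 a2 x / brpm br a1 a2 x).
Proof.
have e1 : k n.+1 + dot (phi R) v = k n.+1 by rewrite pv addr0.
have e2 : k n.+1 + dot (phi R) (- v) = k n.+1 by rewrite dotNr pv subr0.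
have e3 : k n.+1 + dot (phi R) (- u) = k n by rewrite dotNr pu !kS; ring.
have h1 := generically_translate e1 (gauge_neq0 n.+1).
have h2 := generically_translate e2 (gauge_neq0 n.+1).
have h3 := generically_translate e3 (gauge_neq0 n).
have := generically_and h1 (generically_and h2 h3).
apply: genericallyW => x _ [p1 [p2 p3]].
rewrite gSS addrK /pm.
by rewrite [X in X / _]mulrA [g n _ * _]mulrC divfK// mulrAC divff ?mul1r// mulf_neq0.
Qed.

Lemma gauge_unique (g' : nat -> C8 R -> R[i]) :
  generically (H 0) (fun x => g' 0%N x = t0 x) ->
  generically (H 1) (fun x => g' 1%N x = t1 x) ->
  (forall n, generically (H n.+1) (fun x =>
     g' n (x - u) * g' n.+2 (x + u) / pm (g' n.+1) x v = brpm br a0 a2 x / brpm br a1 a2 x)) ->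
  forall n, generically (H n) (fun x => g' n x = g n x).
Proof.
move=> h0 h1 hS n.
suff [] : generically (H n) (fun x => g' n x = g n x) /\
          generically (H n.+1) (fun x => g' n.+1 x = g n.+1 x) by [].
elim: n => [|n [IH1 IH2]]; first by split.
split=> //.
have e1 : k n.+2 + dot (phi R) (v - u) = k n.+1 by rewrite dotBr pv pu !kS; ring.
have e2 : k n.+2 + dot (phi R) (- v - u) = k n.+1 by rewrite dotBr dotNr pv pu !kS; ring.
have e3 : k n.+2 + dot (phi R) (- u - u) = k n by rewrite dotBr dotNr pu !kS; ring.
have e4 : k n.+2 + dot (phi R) (- u) = k n.+1 by rewrite dotNr pu !kS; ring.
have q1 := generically_translate e1 (generically_and IH2 (gauge_neq0 n.+1)).
have q2 := generically_translate e2 (generically_and IH2 (gauge_neq0 n.+1)).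
have q3 := generically_translate e3 (generically_and IH1 (gauge_neq0 n)).
have q4 := generically_translate e4 (hS n).
have := generically_and q1 (generically_and q2 (generically_and q3 q4)).
apply: genericallyW => y _ [[E1 N1] [[E2 N2] [[E3 N3] E4]]].
rewrite subrK /pm in E4.
have p1 : y - u + v = y + (v - u) by vec.
have p2 : y - u - v = y + (- v - u) by vec.
have p3 : y - u - u = y + (- u - u) by vec.
rewrite gSS; rewrite p1 p2 p3 E1 E2 E3 in E4; rewrite p1 p2 p3 -E4.
by field; rewrite N1 N2 N3.
Qed.

(** The ratio property propagates from [t0] and [t1] to all gauge factors. *)
Lemma gauge_ratio n : generically (H n) (ratio (g n)).
Proof.
suff [] : generically (H n) (ratio (g n)) /\ generically (H n.+1) (ratio (g n.+1)) by [].
elim: n => [|n [IH1 IH2]]; first by split.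
split=> //.
have eu (p : C8 R) : dot (phi R) p = 0 -> k n.+2 + dot (phi R) (p - u) = k n.+1.
  by move=> p0; rewrite dotBr p0 pu !kS; ring.
have euu (p : C8 R) : dot (phi R) p = 0 -> k n.+2 + dot (phi R) (p - u - u) = k n.
  by move=> p0; rewrite !dotBr p0 pu !kS; ring.
have zp (p q : C8 R) : dot (phi R) p = 0 -> dot (phi R) q = 0 -> dot (phi R) (p + q) = 0.
  by move=> h1 h2; rewrite dotDr h1 h2 addr0.
have zn (p : C8 R) : dot (phi R) p = 0 -> dot (phi R) (- p) = 0 by move=> h; rewrite dotNr h oppr0.
have z0 : dot (phi R) (0 : C8 R) = 0 by rewrite -(subrr u) dotBr subrr.
have N1 p : dot (phi R) p = 0 -> generically (H n.+2) (fun y => g n.+1 (y + (p - u)) != 0).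
  by move=> h; exact: (generically_translate (eu p h) (gauge_neq0 n.+1)).
have N0 p : dot (phi R) p = 0 -> generically (H n.+2) (fun y => g n (y + (p - u - u)) != 0).
  by move=> h; exact: (generically_translate (euu p h) (gauge_neq0 n)).
have G1 p : dot (phi R) p = 0 -> generically (H n.+2) (fun y => ratio (g n.+1) (y + (p - u))).
  by move=> h; exact: (generically_translate (eu p h) IH2).
have G0 := generically_translate (euu 0 z0) IH1.
have := generically_and (N1 0 z0) (generically_and (N1 _ (zp _ _ pv pv))
  (N1 _ (zp _ _ (zn _ pv) (zn _ pv)))).
move=> /(generically_and (generically_and
  (generically_and (N1 _ (zp _ _ pv pw)) (N1 _ (zp _ _ pv (zn _ pw))))
  (generically_and (N1 _ (zp _ _ (zn _ pv) pw)) (N1 _ (zp _ _ (zn _ pv) (zn _ pw)))))).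
move=> /(generically_and (generically_and
  (generically_and (N0 _ pv) (N0 _ (zn _ pv))) (generically_and (N0 _ pw) (N0 _ (zn _ pw))))).
move=> /(generically_and (generically_and G0 (generically_and (G1 _ pv) (G1 _ (zn _ pv))))).
move=> /(generically_and (generically_translate (euu 0 z0)
  (generically_and (brpm01_neq0 _) (brpm02_neq0 _)))).
move=> /(generically_and (generically_translate (eu 0 z0) (brpm02_neq0 _))).
move=> /(generically_and (generically_translate (eu _ pv) (brpm12_neq0 _))).
move=> /(generically_and (generically_translate (eu _ (zn _ pv)) (brpm12_neq0 _))).
move=> /(generically_and (brpm02_neq0 _)).
apply: genericallyW => y _.
move=> [c12 [f34 [f12 [d12 [[b34 c34] [[r0 [rp rm]] [[[nv nv'] [nw nw']] [[[npp npm] [nmp nmm]] [n0 [np nm]]]]]]]]]].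
set T := dot a0 y; set s := dot a1 y; set r := dot a2 y.
have dE (p : C8 R) (i j l : R[i]) (a : C8 R) : p = i *: u + j *: v + l *: w ->
    dot a (y + p) = dot a y + (i * dot a a0 + j * dot a a1 + l * dot a a2) * delta.
  by move=> ->; rewrite !(dotDr, dotZr); ring.
have dE3 (p : C8 R) (i j l : R[i]) : p = i *: u + j *: v + l *: w ->
    [/\ dot a0 (y + p) = T + i * delta, dot a1 (y + p) = s + j * delta & dot a2 (y + p) = r + l * delta].
  move=> E; split; rewrite (dE p i j l _ E) ?o00 ?o01 ?o02 ?o10 ?o11 ?o12 ?o20 ?o21 ?o22;
    by rewrite !(mulr0, mulr1, addr0, add0r).
have bv (p : C8 R) (i j l : R[i]) : p = i *: u + j *: v + l *: w ->
  [/\ brpm br a0 a1 (y + p) = br (T + i * delta + (s + j * delta)) * br (T + i * delta - (s + j * delta)),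
      brpm br a0 a2 (y + p) = br (T + i * delta + (r + l * delta)) * br (T + i * delta - (r + l * delta)) &
      brpm br a1 a2 (y + p) = br (s + j * delta + (r + l * delta)) * br (s + j * delta - (r + l * delta))].
  by move=> E; have [q1 q2 q3] := dE3 p i j l E; rewrite /brpm /pm q1 q2 q3.
have bc (x z x' z' : R[i]) : x = x' -> z = z' -> br x * br z = br x' * br z' by move=> -> ->.
have Y1 : brpm br a0 a1 y = br (T + s) * br (T - s) by [].
have Y2 : brpm br a0 a2 y = br (T + r) * br (T - r) by [].
have P0 : 0 - u = (-1) *: u + 0 *: v + 0 *: w by vec.
have Pv : v - u = (-1) *: u + 1 *: v + 0 *: w by vec.
have Pv' : - v - u = (-1) *: u + (-1) *: v + 0 *: w by vec.
have Pw : w - u = (-1) *: u + 0 *: v + 1 *: w by vec.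
have Pw' : - w - u = (-1) *: u + 0 *: v + (-1) *: w by vec.
have Puu : 0 - u - u = (- 2) *: u + 0 *: v + 0 *: w by vec.
have [_ Q0 _] := bv _ _ _ _ P0.
have [Qv1 Qv2 Qv3] := bv _ _ _ _ Pv; have [Qv1' Qv2' Qv3'] := bv _ _ _ _ Pv'.
have [_ Qw2 Qw3] := bv _ _ _ _ Pw; have [_ Qw2' Qw3'] := bv _ _ _ _ Pw'.
have [Qu1 Qu2 _] := bv _ _ _ _ Puu.
set D1 := br (T - delta + r); set D2 := br (T - delta - r).
set B1 := br (T + s) in Y1; set B2 := br (T - s) in Y1.
set C1 := br (T + r) in Y2; set C2 := br (T - r) in Y2.
set B3 := br (T - delta *+ 2 + s); set B4 := br (T - delta *+ 2 - s).
set C3 := br (T - delta *+ 2 + r); set C4 := br (T - delta *+ 2 - r).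
set F1 := br (s + delta + r); set F2 := br (s + delta - r).
set F3 := br (s - delta + r); set F4 := br (s - delta - r).
have {}Q0 : brpm br a0 a2 (y + (0 - u)) = D1 * D2 by rewrite Q0; apply: bc; ring.
have {}Qv1 : brpm br a0 a1 (y + (v - u)) = B1 * B4 by rewrite Qv1; apply: bc; ring.
have {}Qv2 : brpm br a0 a2 (y + (v - u)) = D1 * D2 by rewrite Qv2; apply: bc; ring.
have {}Qv3 : brpm br a1 a2 (y + (v - u)) = F1 * F2 by rewrite Qv3; apply: bc; ring.
have {}Qv1' : brpm br a0 a1 (y + (- v - u)) = B3 * B2 by rewrite Qv1'; apply: bc; ring.
have {}Qv2' : brpm br a0 a2 (y + (- v - u)) = D1 * D2 by rewrite Qv2'; apply: bc; ring.
have {}Qv3' : brpm br a1 a2 (y + (- v - u)) = F3 * F4 by rewrite Qv3'; apply: bc; ring.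
have {}Qw2 : brpm br a0 a2 (y + (w - u)) = C1 * C4 by rewrite Qw2; apply: bc; ring.
have {}Qw3 : brpm br a1 a2 (y + (w - u)) = F1 * F4 by rewrite Qw3; apply: bc; ring.
have {}Qw2' : brpm br a0 a2 (y + (- w - u)) = C3 * C2 by rewrite Qw2'; apply: bc; ring.
have {}Qw3' : brpm br a1 a2 (y + (- w - u)) = F3 * F2 by rewrite Qw3'; apply: bc; ring.
have {}Qu1 : brpm br a0 a1 (y + (0 - u - u)) = B3 * B4 by rewrite Qu1; apply: bc; ring.
have {}Qu2 : brpm br a0 a2 (y + (0 - u - u)) = C3 * C4 by rewrite Qu2; apply: bc; ring.
rewrite Y2 mulf_eq0 negb_or in c12; case/andP: c12 => c1 c2.
rewrite Qv3' mulf_eq0 negb_or in f34; case/andP: f34 => f3 f4.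
rewrite Qv3 mulf_eq0 negb_or in f12; case/andP: f12 => f1 f2.
rewrite Q0 mulf_eq0 negb_or in d12; case/andP: d12 => d1 d2.
rewrite Qu1 mulf_eq0 negb_or in b34; case/andP: b34 => b3 b4.
rewrite Qu2 mulf_eq0 negb_or in c34; case/andP: c34 => c3 c4.
rewrite /ratio /pm Qv1 Qv2 in rp; rewrite /ratio /pm Qv1' Qv2' in rm.
rewrite /ratio /pm Qu1 Qu2 in r0.
have x1 : y + (v - u) + v = y + (v + v - u) by vec.
have x2 : y + (v - u) - v = y + (0 - u) by vec.
have x3 : y + (v - u) + w = y + (v + w - u) by vec.
have x4 : y + (v - u) - w = y + (v - w - u) by vec.
have x5 : y + (- v - u) + v = y + (0 - u) by vec.
have x6 : y + (- v - u) - v = y + (- v - v - u) by vec.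
have x7 : y + (- v - u) + w = y + (- v + w - u) by vec.
have x8 : y + (- v - u) - w = y + (- v - w - u) by vec.
have z1 : y + (0 - u - u) + v = y + (v - u - u) by vec.
have z2 : y + (0 - u - u) - v = y + (- v - u - u) by vec.
have z3 : y + (0 - u - u) + w = y + (w - u - u) by vec.
have z4 : y + (0 - u - u) - w = y + (- w - u - u) by vec.
rewrite x1 x2 x3 x4 in rp; rewrite x5 x6 x7 x8 in rm; rewrite z1 z2 z3 z4 in r0.
rewrite /ratio /pm !gSS Y1 Y2.
have l1 : y + v - u = y + (v - u) by vec.
have l2 : y - v - u = y + (- v - u) by vec.
have l3 : y + w - u = y + (w - u) by vec.
have l4 : y - w - u = y + (- w - u) by vec.
have l5 : y + (w - u) + v = y + (v + w - u) by vec.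
have l6 : y + (w - u) - v = y + (- v + w - u) by vec.
have l7 : y + (- w - u) + v = y + (v - w - u) by vec.
have l8 : y + (- w - u) - v = y + (- v - w - u) by vec.
have l9 : y + (v - u) - u = y + (v - u - u) by vec.
have l10 : y + (- v - u) - u = y + (- v - u - u) by vec.
have l11 : y + (w - u) - u = y + (w - u - u) by vec.
have l12 : y + (- w - u) - u = y + (- w - u - u) by vec.
rewrite l1 l2 l3 l4 x1 x2 x5 x6 l5 l6 l7 l8 l9 l10 l11 l12.
rewrite Qv2 Qv3 Qv2' Qv3' Qw2 Qw3 Qw2' Qw3'.
exact: (gauge_ratio_scalar n0 np nm (And4 npp npm nmp nmm) (And4 nv nv' nw nw')
  (conj b3 b4) (And4 c1 c2 c3 c4) (conj d1 d2) (And4 f1 f2 f3 f4) rp rm r0).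
Qed.


Hypothesis delta_Omega :
  [set z | exists l : int, z = l%:~R * delta] `&` [set z | br z = 0] = [set 0].
Hypothesis omega_Omega : br omega = 0.
Variable tau : C8 R -> R[i].
Hypothesis tau_hyp : hypergeometric_tau br omega delta tau.

Lemma H_sub_D n x : H n x -> D_ omega delta x.
Proof. by move=> Hx; exists n%:Z. Qed.

(** [omega + n delta] is not a zero of [br] for [0 < n]. *)
Lemma br_k_neq0 n : br (k n.+1) != 0.
Proof.
apply/eqP => bk.
have b0 := br_zero_sub br_entire br_neq0 br_three_term omega_Omega bk.
have : [set 0] (n.+1%:R * delta).
  by rewrite -delta_Omega; split=> //=; exists n.+1%:Z.
by move=> /= /eqP; rewrite mulf_eq0 (negPf delta_neq0) orbF pnatr_eq0.
Qed.

(** [H n] is relatively open in any set that a vector orthogonal to [phi]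
translates into the union of the hyperplanes, since these are at positive
distance from each other. *)
Lemma H_locally_open n (S : set (C8 R)) p : dot (phi R) p = 0 ->
  (forall x, S x -> D_ omega delta (x + p)) ->
  forall x, H n x -> locally_on S (H n) x.
Proof.
move=> p0 SD x Hx.
have [d d0 hd] : exists2 d : R, 0 < d &
    forall y, vnrm (y - x) < d -> nrm (dot (phi R) y - dot (phi R) x) < nrm delta.
  have cd := differentiable_continuous (differentiable_dot (phi R) x).
  apply/(nbhs_vnrmP x [set y | nrm (dot (phi R) y - dot (phi R) x) < nrm delta]).
  have hN : nbhs (dot (phi R) x) [set t | nrm (t - dot (phi R) x) < nrm delta].
    by apply/nbhs_nrmP; exists (nrm delta) => //; exact: nrm_gt0.
  exact: (cd _ hN).
exists d => // y Sy /hd; have [m _] := SD y Sy.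
rewrite /hyperplane/= dotDr p0 addr0 => Ey.
rewrite Ey Hx /k opprD addrACA subrr add0r -mulrBl.
have -> : m%:~R - n%:R = (m - n%:Z)%:~R :> R[i] by rewrite intrB.
rewrite nrmM gtr_pMl ?nrm_gt0//.
have -> : (m - n%:Z)%:~R = ((m - n%:Z)%:~R : R)%:C by rewrite rmorph_int.
rewrite nrm_real -intr_norm ltrz1 -[1]add0r ltzD1 normr_le0 subr_eq0 => /eqP mn.
by rewrite /H /hyperplane/= Ey mn.
Qed.

Lemma tau_mero n : meromorphic_on (H n) tau.
Proof.
have [[_ mt _] _ _] := tau_hyp.
apply: meromorphic_open_part mt; first by move=> x; exact: H_sub_D.
move=> x; apply: (H_locally_open (p := 0)); first by rewrite -(subrr u) dotBr subrr.
by move=> y; rewrite addr0.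
Qed.

(** The bilinear relation on a single hyperplane, for a frame of type II_1 *)
Lemma tau_bilinear n b0 : C3_frame b0 a1 a2 -> dot (phi R) b0 = 1 ->
  generically (H n.+1) (fun x => brpm br a1 a2 x * pm tau x (delta *: b0)
    + brpm br a2 b0 x * pm tau x v + brpm br b0 a1 x * pm tau x w = 0).
Proof.
move=> fr p0; have [[_ _ E] _ _] := tau_hyp.
apply: generically_open_part (E b0 a1 a2 fr).
  move=> x Hx q; rewrite !inE => hq.
  suff [l hl] : exists l : int, dot (phi R) q = l%:~R.
    exists (n.+1%:Z + l) => //; rewrite /hyperplane/= dotDr dotZr Hx hl /k.
    by rewrite intrD mulrDl addrA [l%:~R * _]mulrC.
  case/orP: hq => [/eqP->|]; first by exists 1; rewrite p0.
  case/orP => [/eqP->|]; first by exists (- 1); rewrite dotNr p0.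
  case/orP => [/eqP->|]; first by exists 0; rewrite phi_a1.
  case/orP => [/eqP->|]; first by exists 0; rewrite dotNr phi_a1 oppr0.
  case/orP => [/eqP->|/eqP->]; first by exists 0; rewrite phi_a2.
  by exists 0; rewrite dotNr phi_a2 oppr0.
apply: (H_locally_open (p := v)); first exact: pv.
by move=> y /(_ a1); apply; rewrite !inE eqxx !orbT.
Qed.

Hypothesis tau1_neq0 : ~ generically (H 1) (fun x => tau x = 0).

(** [tau] vanishes identically on no hyperplane [H n]. *)
Lemma tau_neq0 n : generically (H n) (fun x => tau x != 0).
Proof.
suff [] : generically (H n) (fun x => tau x != 0) /\ generically (H n.+1) (fun x => tau x != 0) by [].
elim: n => [|n [IH0 IH]].
  have k0 : k 0 = omega by rewrite /k mul0r addr0.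
  split; first by case: (meromorphic_dichotomy (@tau_mero 0)) => //; rewrite k0;
    have [_ _] := tau_hyp.
  by case: (meromorphic_dichotomy (@tau_mero 1)).
split=> //; case: (meromorphic_dichotomy (@tau_mero n.+2)) => // Z.
pose b0 := phi R - a0.
have fr : C3_frame b0 a1 a2 by exact: C3_frame_reflect.
have pb : dot (phi R) b0 = 1 by rewrite dotBr dot_phi_phi phi_a0; ring.
have e0 : k n.+1 + dot (phi R) u = k n.+2 by rewrite pu -kS.
have e1 : k n.+1 + dot (phi R) (delta *: b0) = k n.+2 by rewrite dotZr pb mulr1 -kS.
have e2 : k n.+1 + dot (phi R) v = k n.+1 by rewrite pv addr0.
have e3 : k n.+1 + dot (phi R) (- v) = k n.+1 by rewrite dotNr pv subr0.
have e4 : k n.+1 + dot (phi R) w = k n.+1 by rewrite pw addr0.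
have e5 : k n.+1 + dot (phi R) (- w) = k n.+1 by rewrite dotNr pw subr0.
(* a0 - phi / 2 is parallel to the hyperplanes and not orthogonal to phi - 2 a0 *)
have D0 : generically (H n.+1) (fun x => br (dot (phi R - 2 *: a0) x) != 0).
  apply: (@generically_br_dot _ _ br_entire br_neq0 _ _ (a0 - 2^-1 *: phi R)).
    by rewrite dotBr dotZr dot_phi_phi phi_a0; field.
  rewrite dotBr dotZr ![dot (phi R - _) _]dotC !dotBr !dotZr phi_a0 o00 dot_phi_phi dotC phi_a0.
  have -> : 1 - 2 * 1 - 2^-1 * (2 - 2 * 1) = -1 :> R[i] by ring.
  by rewrite oppr_eq0 oner_eq0.
have := generically_and (tau_bilinear n fr pb) (generically_and (tau_bilinear n a_frame phi_a0)
  (generically_and (generically_translate e0 Z) (generically_translate e1 Z))).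
move=> /(generically_and (generically_and
  (generically_and (generically_translate e2 IH) (generically_translate e3 IH))
  (generically_and (generically_translate e4 IH) (generically_translate e5 IH)))).
move=> /(generically_and (generically_and D0 (brpm12_neq0 _))).
have [x0 Hx0] := hyperplane_nonempty (k n.+1).
move=> /(generically_nonempty Hx0)[x Hx [[d0 n12] [[[nv nv'] [nw nw']] [E' [E [Z0 Z1]]]]]].
rewrite /pm Z0 mul0r mulr0 add0r in E; rewrite /pm Z1 mul0r mulr0 add0r in E'.
exfalso.
set A := tau (x + v) * tau (x - v) in E E'; set B := tau (x + w) * tau (x - w) in E E'.
have A0 : A != 0 by rewrite mulf_neq0.
have B0 : B != 0 by rewrite mulf_neq0.
have pmN := pm_br_sym br_entire br_neq0 br_three_term.
set t := dot a0 x; set t' := dot b0 x; set s := dot a1 x; set r := dot a2 x.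
have dBl (p q : C8 R) : dot (p - q) x = dot p x - dot q x by rewrite dotC dotBr !(dotC x).
have tt : t' + t = k n.+1 by rewrite /t' /b0 dBl subrK.
have td : t' - t = dot (phi R - 2 *: a0) x.
  by rewrite /t' /t /b0 !dBl [dot (2 *: a0) x]dotC dotZr [dot x a0]dotC; ring.
have F : pm br t' t * pm br s r = 0.
  have T3 := br_three_term s t' t r.
  have E1 : pm br r t * A = - (pm br t s * B) by apply/eqP; rewrite -addr_eq0; apply/eqP.
  have E2 : pm br r t' * A = - (pm br t' s * B) by apply/eqP; rewrite -addr_eq0; apply/eqP.
  have X : pm br r t * pm br t' s = pm br r t' * pm br t s.
    have AB0 : A * B != 0 by rewrite mulf_neq0.
    apply: (mulIf AB0).
    transitivity ((pm br r t * A) * (pm br t' s * B)); first by ring.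
    rewrite E1; transitivity ((- (pm br t' s * B)) * (pm br t s * B)); first by ring.
    by rewrite -E2; ring.
  rewrite -[RHS]T3 (pmN t r) (pmN s t') (pmN s t).
  rewrite mulrNN X; ring.
move/eqP: F; rewrite mulf_eq0 (negPf (_ : pm br s r != 0))// orbF /pm tt td.
by rewrite mulf_eq0 (negPf (br_k_neq0 n)) (negPf d0).
Qed.

Variable psi : C8 R -> R[i].
Hypothesis tau_t0 : generically (H 0) (fun x => tau x = t0 x).
Hypothesis tau_t1 : generically (H 1) (fun x => tau x = t1 x * psi x).

(** With [K n] the Casorati determinants, [tau] and [g n * K n] agree for
[n = 0, 1] and obey the same recursion. *)
Lemma tau_casorati n :
  generically (H n) (fun x => tau x = g n x * casorati delta a0 a1 a2 psi n x).
Proof.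
suff [] : generically (H n) (fun x => tau x = g n x * casorati delta a0 a1 a2 psi n x) /\
    generically (H n.+1) (fun x => tau x = g n.+1 x * casorati delta a0 a1 a2 psi n.+1 x) by [].
elim: n => [|n [IH0 IH1]].
  split; first by apply: genericallyW tau_t0 => x _ ->; rewrite casorati0 mulr1.
  by apply: genericallyW tau_t1 => x _ ->; rewrite casorati1.
split=> //.
have e0 : k n.+1 + dot (phi R) (- u) = k n by rewrite dotNr pu kS addrK.
have e2 : k n.+1 + dot (phi R) v = k n.+1 by rewrite pv addr0.
have e3 : k n.+1 + dot (phi R) (- v) = k n.+1 by rewrite dotNr pv subr0.
have e4 : k n.+1 + dot (phi R) w = k n.+1 by rewrite pw addr0.
have e5 : k n.+1 + dot (phi R) (- w) = k n.+1 by rewrite dotNr pw subr0.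
have e6 : k n.+2 + dot (phi R) (- u) = k n.+1 by rewrite dotNr pu [k n.+2]kS addrK.
(* the bilinear relation lives on H n.+1, half way between x - u and x + u *)
suff step : generically (H n.+1)
    (fun x => tau (x + u) = g n.+2 (x + u) * casorati delta a0 a1 a2 psi n.+2 (x + u)).
  by have := generically_translate e6 step; apply: genericallyW => x _; rewrite subrK.
have := generically_and (generically_translate e0 (generically_and (tau_neq0 n)
  (generically_and (gauge_neq0 n) IH0))) (generically_and (gauge_ratio n.+1) (tau_bilinear n a_frame phi_a0)).
move=> /(generically_and (generically_and
  (generically_and (generically_translate e2 IH1) (generically_translate e3 IH1))
  (generically_and (generically_translate e4 (generically_and (gauge_neq0 n.+1) IH1))
    (generically_translate e5 (generically_and (gauge_neq0 n.+1) IH1))))).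
move=> /(generically_and (generically_and (brpm12_neq0 _) (brpm02_neq0 _))).
apply: genericallyW => x _ [[n12 n02] [[[Tv Tv'] [[gw Tw] [gw' Tw']]] [[tm [gm Tm]] [G E]]]].
rewrite gSS addrK.
have sym : brpm br a2 a0 x = - brpm br a0 a2 x by exact: pm_br_sym.
rewrite /pm Tv Tv' Tw Tw' sym in E.
have Km0 : casorati delta a0 a1 a2 psi n (x - u) != 0.
  by apply: contraNneq tm => K0; rewrite Tm K0 mulr0.
exact: (casorati_step_scalar n12 n02 tm gm gw gw' E Tm G (casorati_jacobi Km0)).
Qed.

End Hypergeometric.

Unset Implicit Arguments.

Theorem theorem4p3 (R : realType)
  (br : R[i] -> R[i])
  (br_entire : entire br)
  (br_neq0 : exists z, br z != 0)
  (br_three_term : three_term br)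
  (delta : R[i])
  (delta_neq0 : delta != 0)
  (delta_Omega :
     [set z | exists k : int, z = k%:~R * delta] `&` [set z | br z = 0] = [set 0])
  (omega : R[i])
  (omega_Omega : br omega = 0)
  (tau0 tau1 : C8 R -> R[i])
  (tau0_mero : nonzero_meromorphic_on (hyperplane omega) tau0)
  (tau1_mero : nonzero_meromorphic_on (hyperplane (omega + delta)) tau1)
  (tau0_ratio : forall b0 b1 b2 : C8 R,
     C3_frame b0 b1 b2 -> type_II1 b0 b1 b2 ->
     dot (phi R) b0 = 1 -> dot (phi R) b1 = 0 -> dot (phi R) b2 = 0 ->
     generically (hyperplane omega) (fun x =>
       pm tau0 x (delta *: b1) / pm tau0 x (delta *: b2)
       = brpm br b0 b1 x / brpm br b0 b2 x))
  (tau01_bilinear : forall b0 b1 b2 : C8 R,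
     C3_frame b0 b1 b2 ->
     dot (phi R) b0 = 2^-1 -> dot (phi R) b1 = 2^-1 -> dot (phi R) b2 = 2^-1 ->
     generically (hyperplane (omega + delta / 2)) (fun x =>
       brpm br b1 b2 x * tau0 (x - delta *: b0) * tau1 (x + delta *: b0)
       + brpm br b2 b0 x * tau0 (x - delta *: b1) * tau1 (x + delta *: b1)
       + brpm br b0 b1 x * tau0 (x - delta *: b2) * tau1 (x + delta *: b2) = 0))
  (tau : C8 R -> R[i])
  (tau_hyp : hypergeometric_tau br omega delta tau)
  (tau_0 : generically (hyperplane omega) (fun x => tau x = tau0 x))
  (tau_1 : generically (hyperplane (omega + delta)) (fun x => tau x = tau1 x))
  (a0 a1 a2 : C8 R)
  (a_frame : C3_frame a0 a1 a2)
  (a_type : type_II1 a0 a1 a2)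
  (phi_a0 : dot (phi R) a0 = 1)
  (phi_a1 : dot (phi R) a1 = 0)
  (phi_a2 : dot (phi R) a2 = 0)
  (g1 psi : C8 R -> R[i])
  (g1_mero : nonzero_meromorphic_on (hyperplane (omega + delta)) g1)
  (tau1_g1_psi : generically (hyperplane (omega + delta))
     (fun x => tau1 x = g1 x * psi x))
  (g1_ratio : generically (hyperplane (omega + delta)) (fun x =>
     pm g1 x (delta *: a1) / pm g1 x (delta *: a2)
     = brpm br a0 a1 x / brpm br a0 a2 x)) :
  exists g : nat -> C8 R -> R[i],
    [/\ gauge_factors br omega delta a0 a1 a2 tau0 g1 g,
        forall g' : nat -> C8 R -> R[i],
          gauge_factors br omega delta a0 a1 a2 tau0 g1 g' ->
          forall n : nat, generically (hyperplane (omega + n%:R * delta))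
            (fun x => g' n x = g n x)
      & forall n : nat, generically (hyperplane (omega + n%:R * delta))
          (fun x => tau x = g n x * casorati delta a0 a1 a2 psi n x)].
Proof.
have k0 : omega + 0%:R * delta = omega by rewrite mul0r addr0.
have k1 : omega + 1%:R * delta = omega + delta by rewrite mul1r.
have t0_mero : meromorphic_on (hyperplane (omega + 0%:R * delta)) tau0.
  by rewrite k0; exact: tau0_mero.1.
have t1_mero : meromorphic_on (hyperplane (omega + 1%:R * delta)) g1.
  by rewrite k1; exact: g1_mero.1.
have t0_ratio := tau0_ratio a0 a1 a2 a_frame a_type phi_a0 phi_a1 phi_a2.
rewrite -k0 in t0_ratio tau_0; rewrite -k1 in g1_ratio tau_1 tau1_g1_psi.
pose g := gauge br delta a0 a1 a2 tau0 g1.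
have gm n : meromorphic_on (hyperplane (omega + n%:R * delta)) (g n) /\
    generically (hyperplane (omega + n%:R * delta)) (fun x => g n x != 0).
  by have [] := gauge_mero br_entire br_neq0 a_frame phi_a0 phi_a1 phi_a2
    t0_mero t1_mero t0_ratio g1_ratio n.
exists g; split.
- split.
  + move=> n; have [gn gn0] := gm n; split=> //.
    have [x Hx] := hyperplane_nonempty (omega + n%:R * delta).
    exact: generically_neq0_not Hx gn0.
  + by apply: generically_all => x _.
  + by apply: generically_all => x _.
  + case=> [//|n] _.
    exact: (gauge_relation br_entire br_neq0 a_frame phi_a0 phi_a1 phi_a2
      t0_mero t1_mero t0_ratio g1_ratio n).
- move=> g' [_ g'0 g'1 g'S].
  rewrite -k0 in g'0; rewrite -k1 in g'1.
  apply: (gauge_unique br_entire br_neq0 a_frame phi_a0 phi_a1 phi_a2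
      t0_mero t1_mero t0_ratio g1_ratio g'0 g'1) => n.
  exact: (g'S n.+1 isT).
- have tau1_neq0 : ~ generically (hyperplane (omega + 1%:R * delta)) (fun x => tau x = 0).
    move=> h; apply: tau1_mero.2; rewrite -k1.
    by apply: genericallyW (generically_and h tau_1) => x _ [<- ->].
  have tau_1' : generically (hyperplane (omega + 1%:R * delta)) (fun x => tau x = g1 x * psi x).
    by apply: genericallyW (generically_and tau_1 tau1_g1_psi) => x _ [->].
  exact: (tau_casorati br_entire br_neq0 br_three_term delta_neq0 a_frame phi_a0 phi_a1 phi_a2
    t0_mero t1_mero t0_ratio g1_ratio delta_Omega omega_Omega tau_hyp tau1_neq0 tau_0 tau_1').
Qed.
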